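(* Let $k$ be a field and let $G$ be an affine group scheme over $k$, written as an inverse limit $G = \varprojlim_{i \in I} G_i$ over a directed poset $I$ of affine group schemes $G_i$ of finite type over $k$. Let $P$ be a $G$-torsor over $k$. Then $P$ is a directed inverse limit of affine schemes of finite type over $k$ with faithfully flat transition maps; moreover, the directed poset over which this limit is taken can be chosen to have the same cardinality as $I$. That is, there exist a directed poset $\Omega$ with $\mathrm{card}\,\Omega = \mathrm{card}\, I$ and an inverse system $(P_\omega)_{\omega \in \Omega}$ of affine schemes of finite type over $k$, with all transition morphisms $P_{\omega_2} \to P_{\omega_1}$ ($\omega_1 \le \omega_2$) faithfully flat morphisms over $k$, such that $P \cong \varprojlim_{\omega \in \Omega} P_\omega$ as schemes over $k$.
   Context: A directed poset is a non-empty partially ordered set in which any two elements have a common upper bound. The inverse limit $G = \varprojlim_{i\in I} G_i$ is taken in the category of affine group schemes over $k$, over an inverse system indexed by $I$ whose transition maps are homomorphisms of group schemes over $k$. (Any affine group scheme over a field can be written as such a limit.) A $G$-torsor $P$ over $k$ is a non-empty affine scheme $P$ over $k$ with an action of $G$ (over $k$) such that the morphism $G \times_k P \to P \times_k P$, $(g,p) \mapsto (gp,p)$, is an isomorphism. $P$ is not assumed to be of finite type over $k$. *)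

(* Defs.v *)
(* Affine k-schemes are handled through the anti-equivalence with commutative
   k-algebras: [A : comAlgType k] stands for Spec A, and a k-morphism
   Spec B -> Spec A is a k-algebra morphism [{lrmorphism A -> B}] (arrows are
   reversed).  MathComp's [comAlgType] imposes 1 != 0, so the affine schemes
   considered are exactly the non-empty ones.  Group schemes and torsors are
   non-empty by definition, a scheme receiving a map from a non-empty one is
   non-empty, and the empty scheme has exactly one map to any scheme, so it is
   irrelevant as a test object in the universal properties below. *)
From HB Require Import structures.
From mathcomp Require Import all_boot all_order all_algebra.
From mathcomp Require Import mpoly.

Set Implicit Arguments.
Unset Strict Implicit.
Unset Printing Implicit Defensive.

Import Order.TTheory GRing.Theory.
Local Open Scope ring_scope.

Definition directed (d : Order.disp_t) (I : porderType d) : Prop :=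
  inhabited I /\ forall i j : I, exists l : I, (i <= l)%O /\ (j <= l)%O.

Section FaithfullyFlat.

Definition bilinear_map (R : comNzRingType) (M N T : lmodType R)
    (t : M -> N -> T) : Prop :=
  (forall m, linear (t m)) /\ (forall n, linear (t^~ n)).

(* (T, t) is a tensor product of M and N over R. *)
Definition is_tensor_product (R : comNzRingType) (M N T : lmodType R)
    (t : M -> N -> T) : Prop :=
  bilinear_map t /\
  forall (Q : lmodType R) (q : M -> N -> Q), bilinear_map q ->
    exists h : {linear T -> Q},
      (forall m n, h (t m n) = q m n) /\
      forall h' : {linear T -> Q}, (forall m n, h' (t m n) = q m n) -> h' =1 h.

(* - (x)_R N preserves injectivity; [h] is the induced map u (x) id_N. *)
Definition flat_module (R : comNzRingType) (N : lmodType R) : Prop :=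
  forall (M M' : lmodType R) (u : {linear M -> M'}), injective u ->
  forall (T T' : lmodType R) (t : M -> N -> T) (t' : M' -> N -> T'),
    is_tensor_product t -> is_tensor_product t' ->
  forall h : {linear T -> T'}, (forall m n, h (t m n) = t' (u m) n) ->
    injective h.

(* B as an A-module, by restriction of scalars along f. *)
Definition restr_scalars (A B : comNzRingType) (f : {rmorphism A -> B}) :
  Type := B.

Section RestrScalars.
Variables (A B : comNzRingType) (f : {rmorphism A -> B}).
Local Notation V := (restr_scalars f).

HB.instance Definition _ := GRing.Zmodule.copy V B.

Definition restr_scale (a : A) (b : V) : V := f a * (b : B).

Fact restr_scaleA a b v :
  restr_scale a (restr_scale b v) = restr_scale (a * b) v.
Proof. by rewrite /restr_scale rmorphM mulrA. Qed.

Fact restr_scale1 : left_id 1 restr_scale.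
Proof. by move=> v; rewrite /restr_scale rmorph1 mul1r. Qed.

Fact restr_scaleDr : right_distributive restr_scale +%R.
Proof. by move=> a u v; exact: mulrDr. Qed.

Fact restr_scaleDl v : {morph restr_scale^~ v : a b / a + b}.
Proof. by move=> a b; rewrite /restr_scale rmorphD; exact: mulrDl. Qed.

HB.instance Definition _ := GRing.Zmodule_isLmodule.Build A V
  restr_scaleA restr_scale1 restr_scaleDr restr_scaleDl.
End RestrScalars.

(* [idealr_closed] ideals are proper.  Ideals are boolean predicates, which is
   no restriction classically. *)
Definition prime_ideal (A : comNzRingType) (p : {pred A}) : Prop :=
  idealr_closed p /\ prime_idealr_closed p.

(* Spec B -> Spec A is flat and surjective. *)
Definition faithfully_flat (A B : comNzRingType) (f : {rmorphism A -> B}) :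
    Prop :=
  flat_module (restr_scalars f) /\
  forall p : {pred A}, prime_ideal p ->
    exists q : {pred B}, prime_ideal q /\ forall a, (f a \in q) = (a \in p).

End FaithfullyFlat.

Section AffineSchemes.
Variable k : fieldType.

(* Spec A is of finite type over k. *)
Definition finite_type (A : comAlgType k) : Prop :=
  exists (n : nat) (f : {lrmorphism {mpoly k[n]} -> A}),
    forall a, exists q, f q = a.

Definition is_alg_iso (A B : comAlgType k) (f : {lrmorphism A -> B}) : Prop :=
  exists g : {lrmorphism B -> A}, cancel f g /\ cancel g f.

(* The set (Spec A)(R) of R-points. *)
Definition points (A R : comAlgType k) : Type := {lrmorphism A -> R}.

(* As [x : points B C], [acomp f x] is the image of the point x under the
   morphism Spec B -> Spec A given by f; as [f : points A B], it is the
   base change of the point f along x. *)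
Definition acomp (A B C : comAlgType k)
    (f : {lrmorphism A -> B}) (x : {lrmorphism B -> C}) : {lrmorphism A -> C} :=
  x \o f.

(* Spec C, with the projections given by p and q, is the product of Spec A and
   Spec B over k. *)
Definition is_product (A B C : comAlgType k)
    (p : {lrmorphism A -> C}) (q : {lrmorphism B -> C}) : Prop :=
  forall (T : comAlgType k) (f : points A T) (g : points B T),
    exists! h : points C T, acomp p h = f /\ acomp q h = g.

(* Group structure on Spec A, as a functorial group structure on points. *)
Record group_scheme := GroupScheme {
  gring : comAlgType k;
  gmul : forall R, points gring R -> points gring R -> points gring R;
  gone : forall R, points gring R;
  ginv : forall R, points gring R -> points gring R;
  gmulA : forall R, associative (@gmul R);
  gmul1 : forall R, left_id (gone R) (@gmul R);
  gmulV : forall R, left_inverse (gone R) (@ginv R) (@gmul R);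
  gmul_nat : forall (R S : comAlgType k) (phi : {lrmorphism R -> S})
      (x y : points gring R),
    acomp (gmul x y) phi = gmul (acomp x phi) (acomp y phi)
}.

(* The morphism H -> G given by f is a homomorphism of group schemes. *)
Definition group_hom (G H : group_scheme)
    (f : {lrmorphism gring G -> gring H}) : Prop :=
  forall R (x y : points (gring H) R),
    acomp f (gmul x y) = gmul (acomp f x) (acomp f y).

Record torsor (G : group_scheme) := Torsor {
  tring : comAlgType k;
  tact : forall R, points (gring G) R -> points tring R -> points tring R;
  tact1 : forall R (x : points tring R), tact (gone G R) x = x;
  tactM : forall R (g h : points (gring G) R) (x : points tring R),
    tact (gmul g h) x = tact g (tact h x);
  tact_nat : forall (R S : comAlgType k) (phi : {lrmorphism R -> S})
      (g : points (gring G) R) (x : points tring R),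
    acomp (tact g x) phi = tact (acomp g phi) (acomp x phi);
  (* [theta] is the morphism G x P -> P x P, (g, x) |-> (g x, x), evaluated at
     the universal point (p1, p2) of G x P. *)
  torsor_iso :
    exists (GP : comAlgType k)
      (p1 : points (gring G) GP) (p2 : points tring GP)
      (PP : comAlgType k) (q1 q2 : points tring PP)
      (theta : {lrmorphism PP -> GP}),
    [/\ is_product p1 p2, is_product q1 q2,
        acomp q1 theta = tact p1 p2, acomp q2 theta = p2
      & is_alg_iso theta]
}.

Section Limits.
Variables (d : Order.disp_t) (I : porderType d).

(* Inverse system of affine schemes; [strans i j] is the transition map
   Spec (sobj j) -> Spec (sobj i), for i <= j. *)
Record inverse_system := InverseSystem {
  sobj : I -> comAlgType k;
  strans : forall i j : I, (i <= j)%O -> {lrmorphism sobj i -> sobj j};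
  strans_id : forall i (h : (i <= i)%O), strans h =1 id;
  strans_comp : forall i j l (hij : (i <= j)%O) (hjl : (j <= l)%O)
      (hil : (i <= l)%O), strans hjl \o strans hij =1 strans hil
}.

Definition is_cone (S : inverse_system) (A : comAlgType k)
    (p : forall i, {lrmorphism sobj S i -> A}) : Prop :=
  forall i j (h : (i <= j)%O), p j \o strans S h =1 p i.

(* The cone p exhibits Spec A as the limit of S. *)
Definition is_limit (S : inverse_system) (A : comAlgType k)
    (p : forall i, {lrmorphism sobj S i -> A}) : Prop :=
  is_cone p /\
  forall (B : comAlgType k) (q : forall i, {lrmorphism sobj S i -> B}),
    is_cone q ->
    exists! u : {lrmorphism A -> B}, forall i, u \o p i =1 q i.

Record group_inverse_system := GroupInverseSystem {
  gobj : I -> group_scheme;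
  gtrans : forall i j : I, (i <= j)%O ->
    {lrmorphism gring (gobj i) -> gring (gobj j)};
  gtrans_hom : forall i j (h : (i <= j)%O), group_hom (gtrans h);
  gtrans_id : forall i (h : (i <= i)%O), gtrans h =1 id;
  gtrans_comp : forall i j l (hij : (i <= j)%O) (hjl : (j <= l)%O)
      (hil : (i <= l)%O), gtrans hjl \o gtrans hij =1 gtrans hil
}.

Definition is_group_cone (S : group_inverse_system) (G : group_scheme)
    (p : forall i, {lrmorphism gring (gobj S i) -> gring G}) : Prop :=
  (forall i, group_hom (p i)) /\
  forall i j (h : (i <= j)%O), p j \o gtrans S h =1 p i.

(* The cone p exhibits G as the limit of S in affine group schemes. *)
Definition is_group_limit (S : group_inverse_system) (G : group_scheme)
    (p : forall i, {lrmorphism gring (gobj S i) -> gring G}) : Prop :=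
  is_group_cone p /\
  forall (H : group_scheme)
      (q : forall i, {lrmorphism gring (gobj S i) -> gring H}),
    is_group_cone q ->
    exists! u : {lrmorphism gring G -> gring H},
      group_hom u /\ forall i, u \o p i =1 q i.

End Limits.

End AffineSchemes.

(* Main.v *)
(* Let H = k[G] and B = k[P]. By the universal property of G, H is the directed
   union of the images K_i of the k[G_i], which are sub-Hopf algebras. Let B_i be
   the algebra of those b in B whose coaction lies in K_i (x) B, that is, the ring
   of the quotient of P by the kernel of G -> Spec K_i; then B is the directed
   union of the B_i and Omega = I works.

   Finite type: the isomorphism B (x) B = H (x) B restricts to an isomorphism
   B_i (x) B = K_i (x) B, so finitely many coefficients of the inverse images of
   the generators of K_i generate B_i.

   Faithful flatness: elements of B lie in finite G-stable subspaces, with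
   generators h_1, ..., h_n say. The minors of size r of the relations
   sum_l a_l h_l = 0 with a in B_i^n generate a G-stable ideal of B_i, hence 0 or
   the whole B_i because G is transitive on P. So the module of these relations is
   a direct summand of B_i^n, which gives the equational criterion of flatness.
   The same argument for the relations sum_l a_l h_l in B_i shows that every ideal
   of B_i is contracted from B. *)
Require Import Defs.
From HB Require Import structures.
From mathcomp Require Import mpoly.
From mathcomp Require Import all_boot all_order all_algebra.
From mathcomp Require Import zify boolp classical_sets generic_quotient.

Set Implicit Arguments.
Unset Strict Implicit.
Unset Printing Implicit Defensive.

Import GRing.Theory.
Local Open Scope ring_scope.

(** * Zorn's lemma and linear functionals *)

(** Group laws and actions are given on points, so no coalgebra is set up. An element of A (x) B is
    a list of pairs, an identity is checked at all pairs of points, and a natural operation is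
    expanded at the universal pair. Coefficients are read off by slicing with linear functionals,
    which Zorn's lemma provides in any dimension. In a list with independent entries on both sides
    every entry is a slice; this shows that entries stay in [K] or in B_i. A point of a sub-Hopf
    algebra need not extend to a point of H with values in the same ring, so identities descend to
    it through the injectivity, over a field, of tensor products of injective maps. Flatness is
    required of B_i -> B_j and not only of B_i -> B. Hence the h_l are kept in B_j, while the
    projector onto the relations has entries in B_i. The minors of relations span a stable ideal
    because G acts on the h_l by an invertible matrix. If r is the largest size of a nonzero minor,
    Cramer's rule recovers each relation, multiplied by an r-minor, from r relations; writing 1 as a
    combination of r-minors glues these formulas into a projector. *)

Lemma zorn_above (T : Type) (Q : set (set T)) (X0 : set T) :
  Q X0 ->
  (forall F : set (set T), (F !=set0)%classic -> (F `<=` Q)%classic ->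
     total_on F subset -> Q (\bigcup_(X in F) X)%classic) ->
  exists X : set T, [/\ Q X, (X0 `<=` X)%classic &
    forall Y, Q Y -> (X `<=` Y)%classic -> (Y `<=` X)%classic].
Proof.
move=> Q0 chainQ.
have [|A [A_Q A_max]] := @Zorn_bigcup T
    (fun X => X = set0 \/ Q X /\ (X0 `<=` X)%classic).
  move=> F FQ Ftot.
  have [[X [FX X_n0]]|noX] := pselect (exists X, F X /\ X <> set0); last first.
    left; rewrite -subset0 => x [X FX Xx].
    by case: noX; exists X; split=> // X0'; rewrite X0' in Xx.
  right; split; last first.
    have [/X_n0//|[_ X0X]] := FQ _ FX.
    by move=> x /X0X Xx; exists X.
  have -> : (\bigcup_(X in F) X)%classic =
            (\bigcup_(X in [set Y | F Y /\ Y <> set0]) X)%classic.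
    apply/seteqP; split=> x [Y FY Yx]; exists Y => //; last by case: FY.
    by split=> // Y0; rewrite Y0 in Yx.
  apply: chainQ; first by exists X.
    by move=> Y [/FQ[]// [QY _] _].
  by move=> Y Z [FY _] [FZ _]; apply: Ftot.
have X0A : (X0 `<=` A)%classic.
  case: A_Q => [A0|[]//] x X0x.
  exfalso; apply: (A_max X0); last by right; split.
  by rewrite A0; split=> // /(_ _ X0x).
have QA : Q A.
  case: A_Q => [A0|[]//]; suff -> : A = X0 by [].
  by apply/seteqP; split=> //; rewrite A0.
exists A; split=> // Y QY AY; apply: contrapT => nYA.
by apply: (A_max Y) => //; right; split=> // x /X0A /AY.
Qed.

Definition submodule (R : nzRingType) (V : lmodType R) (W : V -> Prop) : Prop :=
  W 0 /\ forall a u v, W u -> W v -> W (a *: u + v).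

Section Submodule.
Variables (R : nzRingType) (V : lmodType R) (W : V -> Prop).
Hypothesis W_sub : submodule W.

Lemma submodule0 : W 0. Proof. by case: W_sub. Qed.

Lemma submoduleD u v : W u -> W v -> W (u + v).
Proof. by case: W_sub => _ WL /(WL 1) h /h; rewrite scale1r. Qed.

Lemma submoduleZ a u : W u -> W (a *: u).
Proof. by case: W_sub => W0 WL /(WL a) /(_ W0); rewrite addr0. Qed.

Lemma submoduleN u : W u -> W (- u).
Proof. by rewrite -scaleN1r; apply: submoduleZ. Qed.

Lemma submodule_sum (I : Type) (s : seq I) (P : pred I) (F : I -> V) :
  (forall i, P i -> W (F i)) -> W (\sum_(i <- s | P i) F i).
Proof. by move=> WF; apply: (big_ind W submodule0 submoduleD). Qed.

Lemma submodule_sum_seq (I : eqType) (s : seq I) (F : I -> V) :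
  (forall i, i \in s -> W (F i)) -> W (\sum_(i <- s) F i).
Proof. by move=> WF; rewrite big_seq; apply: submodule_sum. Qed.
End Submodule.

Lemma submodule_chain (R : nzRingType) (V : lmodType R) (F : set (set V)) :
  (F !=set0)%classic -> (forall W, F W -> submodule W) -> total_on F subset ->
  submodule (\bigcup_(W in F) W)%classic.
Proof.
move=> [W0 FW0] Fsub Ftot; split.
  by exists W0 => //; apply: submodule0; apply: Fsub.
move=> a u v [W FW Wu] [W' FW' W'v].
have [WW'|W'W] := Ftot _ _ FW FW'.
  by exists W' => //; apply: (Fsub _ FW').2 => //; apply: WW'.
by exists W => //; apply: (Fsub _ FW).2 => //; apply: W'W.
Qed.

(* A maximal subspace among those containing W and avoiding v is a hyperplane
   complementary to the line of v. *)
Lemma functional_sep (k : fieldType) (V : lmodType k) (W : V -> Prop) (v : V) :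
  submodule W -> ~ W v ->
  exists phi : {scalar V}, phi v = 1 /\ forall w, W w -> phi w = 0.
Proof.
move=> Wsub Wv.
have [|F F0 FQ Ftot|H [[Hsub Hv] WH Hmax]] :=
  @zorn_above V (fun X => submodule X /\ ~ X v) W.
- by split.
- split; first by apply: submodule_chain => // X /FQ[].
  by move=> [X /FQ[_ Xv] /Xv].
have dec u : exists c, H (u - c *: v).
  have [Hu|Hu] := pselect (H u); first by exists 0; rewrite scale0r subr0.
  (* [Y] is H + k u. For u outside H, maximality puts v in [Y], and v - a u in H with a != 0 gives
     the coefficient [a^-1]. *)
  pose Y w := exists a, H (w - a *: u).
  have Ysub : submodule Y.
    split; first by exists 0; rewrite scale0r subr0; apply: submodule0.
    move=> a x y [b Hx] [c Hy]; exists (a * b + c).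
    by rewrite scalerDl opprD addrACA -scalerA -scalerBr; apply: Hsub.2.
  have [[a Ha]|Yv] := pselect (Y v); last first.
    exfalso; apply: Hu; apply: (Hmax Y) => //.
      by move=> x Hx; exists 0; rewrite scale0r subr0.
    by exists 1; rewrite scale1r subrr; apply: submodule0.
  have a0 : a != 0.
    by apply/eqP => a0; apply: Hv; move: Ha; rewrite a0 scale0r subr0.
  exists a^-1; move: (submoduleZ Hsub (- a^-1) Ha).
  by rewrite scalerBr scalerA mulNr mulVf // !scaleNr opprK scale1r addrC.
have unq u c c' : H (u - c *: v) -> H (u - c' *: v) -> c = c'.
  move=> h h'; apply/eqP; rewrite -subr_eq0; case: eqVneq => // n0; exfalso.
  apply: Hv; have := submoduleD Hsub h' (submoduleN Hsub h).
  rewrite opprB addrC addrA subrK -scalerBl => /(submoduleZ Hsub (c - c')^-1).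
  by rewrite scalerA mulVf // scale1r.
pose f u := projT1 (cid (dec u)).
have fP u : H (u - f u *: v) by rewrite /f; case: cid.
have f_lin : scalar f.
  move=> a x y; apply: unq (fP _) _.
  by rewrite scalerDl -scalerA opprD addrACA -scalerBr; apply: Hsub.2.
pose fL := GRing.isLinear.Build k V k *%R f f_lin.
pose phi : {scalar V} := HB.pack f fL.
exists phi; split.
  by apply: (unq v) (fP _) _; rewrite scale1r subrr; apply: submodule0.
move=> w /WH Hw; apply: (unq w) (fP _) _.
by rewrite scale0r subr0.
Qed.

Lemma functional_neq0 (k : fieldType) (V : lmodType k) (v : V) :
  v <> 0 -> exists phi : {scalar V}, phi v = 1.
Proof.
move=> v0; have [||phi [phi1 _]] := @functional_sep k V (fun u => u = 0) v.
- by split=> // a x y -> ->; rewrite scaler0 addr0.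
- by [].
by exists phi.
Qed.

(** * Tensor products as quotients of formal sums *)

Section FormalSums.
Variables (R : comNzRingType) (M N : lmodType R).

Definition fneg (s : seq (M * N)) := [seq (- p.1, p.2) | p <- s].
Definition fscale (a : R) (s : seq (M * N)) := [seq (a *: p.1, p.2) | p <- s].

(* The formal sums that a quotient of M (x) N kills. *)
Record null_family := NullFamily {
  null :> seq (M * N) -> Prop;
  null_cat : forall s t, null s -> null t -> null (s ++ t);
  null_perm : forall s t, perm_eq s t -> null s -> null t;
  null_pair : forall m n, null [:: (m, n); (- m, n)];
  null_cancel : forall m n s, null [:: (m, n), (- m, n) & s] -> null s;
  null_scale : forall a s, null s -> null (fscale a s);
  null_linl : forall a m m' n,
    null [:: (a *: m + m', n); (- (a *: m), n); (- m', n)];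
  null_linr : forall a m n n',
    null [:: (m, a *: n + n'); (- (a *: m), n); (- m, n')]
}.

Variable Z : null_family.

Lemma fnegK : involutive fneg.
Proof.
by elim=> // -[m n] s IHs /=; rewrite opprK; congr (_ :: _); exact: IHs.
Qed.

Lemma fneg_cat s t : fneg (s ++ t) = fneg s ++ fneg t.
Proof. exact: map_cat. Qed.

Lemma fneg_scale s : fscale (-1) s = fneg s.
Proof. by apply: eq_map => -[m n] /=; rewrite scaleN1r. Qed.

Lemma null_negr s : Z (s ++ fneg s).
Proof.
elim: s => [|[m n] s IHs] /=.
  exact: null_cancel (null_pair Z 0 0).
apply: null_perm (null_cat (null_pair Z m n) IHs).
apply/permP => a; rewrite !count_cat /= !count_cat /=; lia.
Qed.

Lemma null_cancel_cat s t : Z (s ++ fneg s ++ t) -> Z t.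
Proof.
elim: s => [|[m n] s IHs] //= h; apply: IHs.
apply: (@null_cancel Z m n); apply: null_perm h.
apply/permP => a; rewrite /= !count_cat /= count_cat; lia.
Qed.

Definition fequiv (s t : seq (M * N)) : bool := `[< Z (s ++ fneg t) >].

Lemma fequiv_refl : reflexive fequiv.
Proof. by move=> s; apply/asboolP; apply: null_negr. Qed.

Lemma fequiv_sym : symmetric fequiv.
Proof.
suff h s t : fequiv s t -> fequiv t s by move=> s t; apply/idP/idP; apply: h.
move=> /asboolP /(null_scale (-1)); rewrite fneg_scale => h; apply/asboolP.
apply: null_perm h; by rewrite fneg_cat fnegK perm_catC.
Qed.

Lemma fequiv_trans : transitive fequiv.
Proof.
move=> t s u /asboolP st /asboolP tu; apply/asboolP.
apply: (@null_cancel_cat t); apply: null_perm (null_cat st tu).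
apply/permP => a; rewrite !count_cat; lia.
Qed.

Canonical fequiv_equiv := EquivRel fequiv fequiv_refl fequiv_sym fequiv_trans.

(** The null family is a parameter because the construction serves twice: with the sums killed by
    all bilinear maps it is the tensor product, and with the sums that vanish for an equational
    reason it is the test module of the flatness criterion. *)
Definition fquot := {eq_quot fequiv}%qT.
HB.instance Definition _ := Choice.on fquot.
HB.instance Definition _ := EqQuotient.on fquot.

Definition fclass (s : seq (M * N)) : fquot := (\pi_fquot s)%qT.

Lemma fclassP s t : fclass s = fclass t <-> Z (s ++ fneg t).
Proof. by split=> [/eqquotP/asboolP|h] //; apply/eqquotP/asboolP. Qed.

Lemma fclass_repr x : fclass (repr x) = x. Proof. exact: reprK. Qed.

Definition fadd (x y : fquot) := fclass (repr x ++ repr y).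
Definition fopp (x : fquot) := fclass (fneg (repr x)).
Definition fscl a (x : fquot) := fclass (fscale a (repr x)).

Lemma repr_class s : Z (repr (fclass s) ++ fneg s).
Proof. by apply/fclassP; rewrite fclass_repr. Qed.

Lemma faddE s t : fadd (fclass s) (fclass t) = fclass (s ++ t).
Proof.
apply/fclassP; apply: null_perm (null_cat (repr_class s) (repr_class t)).
apply/permP => a; rewrite fneg_cat !count_cat; lia.
Qed.

Lemma fscale_neg a s : fscale a (fneg s) = fneg (fscale a s).
Proof. by rewrite /fscale /fneg -!map_comp; apply: eq_map => p /=; rewrite scalerN. Qed.

Lemma fsclE a s : fscl a (fclass s) = fclass (fscale a s).
Proof.
apply/fclassP; rewrite -fscale_neg -[_ ++ _]map_cat.
by apply: null_scale; exact: repr_class.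
Qed.

Lemma foppE s : fopp (fclass s) = fclass (fneg s).
Proof. by rewrite -fneg_scale -fsclE /fscl fneg_scale. Qed.

Lemma fquot_ind (P : fquot -> Prop) : (forall s, P (fclass s)) -> forall x, P x.
Proof. by move=> h x; rewrite -[x]fclass_repr. Qed.

Fact faddA : associative fadd.
Proof.
elim/fquot_ind=> s; elim/fquot_ind=> t; elim/fquot_ind=> u.
by rewrite !faddE catA.
Qed.

Fact faddC : commutative fadd.
Proof.
elim/fquot_ind=> s; elim/fquot_ind=> t; rewrite !faddE.
apply/fclassP; apply: null_perm (null_negr (t ++ s)).
by rewrite perm_cat2r perm_catC.
Qed.

Fact fadd0 : left_id (fclass [::]) fadd.
Proof. by elim/fquot_ind=> s; rewrite faddE. Qed.

Fact faddN : left_inverse (fclass [::]) fopp fadd.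
Proof.
elim/fquot_ind=> s; rewrite foppE faddE; apply/fclassP.
by apply: null_perm (null_negr s); rewrite cats0 perm_catC.
Qed.

HB.instance Definition _ :=
  GRing.isZmodule.Build fquot faddA faddC fadd0 faddN.

Lemma fclassD s t : fclass (s ++ t) = fclass s + fclass t.
Proof. by rewrite -faddE. Qed.

Lemma fclass0P s : fclass s = 0 <-> Z s.
Proof.
have -> : (0 : fquot) = fclass [::] by [].
by split=> [/fclassP|h]; [|apply/fclassP]; rewrite cats0.
Qed.

Lemma fclassN s : fclass (fneg s) = - fclass s.
Proof. by rewrite -foppE. Qed.

Lemma fclass_cons p s : fclass (p :: s) = fclass [:: p] + fclass s.
Proof. by rewrite -fclassD. Qed.

Lemma fclass_opp1 m n : fclass [:: (- m, n)] = - fclass [:: (m, n)].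
Proof. by rewrite -fclassN. Qed.

Lemma fclass3 p m n m' n' : Z [:: p; (- m, n); (- m', n')] ->
  fclass [:: p] = fclass [:: (m, n)] + fclass [:: (m', n')].
Proof.
move/fclass0P; rewrite fclass_cons -[[:: (- m, n); _]]/([:: _] ++ [:: _]).
by rewrite fclassD !fclass_opp1 -opprD => /eqP; rewrite subr_eq0 => /eqP.
Qed.

Fact fsclA a b x : fscl a (fscl b x) = fscl (a * b) x.
Proof.
elim/fquot_ind: x => s; rewrite !fsclE; congr fclass.
by rewrite /fscale -map_comp; apply: eq_map => p /=; rewrite scalerA.
Qed.

Fact fscl1 : left_id 1 fscl.
Proof.
elim/fquot_ind=> s; rewrite fsclE; congr fclass.
by rewrite /fscale -[RHS]map_id; apply: eq_map => -[m n] /=; rewrite scale1r.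
Qed.

Fact fsclDr : right_distributive fscl +%R.
Proof.
move=> a; elim/fquot_ind=> s; elim/fquot_ind=> t.
by rewrite -fclassD !fsclE -fclassD -map_cat.
Qed.

Fact fsclDl x : {morph fscl^~ x : a b / a + b}.
Proof.
move=> a b; elim/fquot_ind: x => s; rewrite !fsclE.
elim: s => [|[m n] s IHs] /=; first by rewrite addr0.
rewrite (fclass_cons _ (fscale (a + b) s)) (fclass_cons _ (fscale a s)).
rewrite (fclass_cons _ (fscale b s)) IHs addrACA; congr (_ + _).
by rewrite scalerDl; apply: fclass3 (null_linl Z a m (b *: m) n).
Qed.

HB.instance Definition _ := GRing.Zmodule_isLmodule.Build R fquot
  fsclA fscl1 fsclDr fsclDl.

Definition fpure (m : M) (n : N) : fquot := fclass [:: (m, n)].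

Lemma fpureZ a m n : fpure (a *: m) n = a *: fpure m n.
Proof. exact: (esym (fsclE a [:: (m, n)])). Qed.

Lemma fpure_bilinear : bilinear_map fpure.
Proof.
split=> [m a n n'|n a m m'].
  by rewrite -fpureZ; apply: fclass3 (null_linr Z a m n n').
by rewrite -fpureZ; apply: fclass3 (null_linl Z a m m' n).
Qed.

Lemma fclass_sum s : fclass s = \sum_(p <- s) fpure p.1 p.2.
Proof.
elim: s => [|[m n] s IHs]; first by rewrite big_nil.
by rewrite big_cons fclass_cons IHs.
Qed.
End FormalSums.

Section Bilinear.
Variables (R : comNzRingType) (M N Q : lmodType R) (q : M -> N -> Q).
Hypothesis q_bil : bilinear_map q.

Lemma bilDl m m' n : q (m + m') n = q m n + q m' n.
Proof. by have := q_bil.2 n 1 m m'; rewrite !scale1r. Qed.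

Lemma bilDr m n n' : q m (n + n') = q m n + q m n'.
Proof. by have := q_bil.1 m 1 n n'; rewrite !scale1r. Qed.

Lemma bil0l n : q 0 n = 0.
Proof. by apply: (addIr (q 0 n)); rewrite -bilDl !add0r. Qed.

Lemma bil0r m : q m 0 = 0.
Proof. by apply: (addIr (q m 0)); rewrite -bilDr !add0r. Qed.

Lemma bilZl a m n : q (a *: m) n = a *: q m n.
Proof. by have := q_bil.2 n a m 0; rewrite bil0l !addr0. Qed.

Lemma bilZr a m n : q m (a *: n) = a *: q m n.
Proof. by have := q_bil.1 m a n 0; rewrite bil0r !addr0. Qed.

Lemma bilNl m n : q (- m) n = - q m n.
Proof. by rewrite -!scaleN1r bilZl. Qed.

Lemma bil_suml (I : Type) (s : seq I) (F : I -> M) n :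
  q (\sum_(i <- s) F i) n = \sum_(i <- s) q (F i) n.
Proof. exact: (big_morph _ (fun m m' => bilDl m m' n) (bil0l n)). Qed.

Lemma bil_sumr (I : Type) (s : seq I) (F : I -> N) m :
  q m (\sum_(i <- s) F i) = \sum_(i <- s) q m (F i).
Proof. exact: (big_morph _ (bilDr m) (bil0r m)). Qed.
End Bilinear.

Section Tensor.
Variables (R : comNzRingType) (M N : lmodType R).

(** The relations are taken from the universal property itself, so that a bilinear map factors
    through the quotient without any study of generating relations. *)
Definition tensor_null (s : seq (M * N)) : Prop :=
  forall (Q : lmodType R) (q : M -> N -> Q), bilinear_map q ->
    \sum_(p <- s) q p.1 p.2 = 0.

Fact tensor_null_family : null_family M N.
Proof.
exists tensor_null.
- by move=> s t s0 t0 Q q qb; rewrite big_cat /= (s0 _ _ qb) (t0 _ _ qb) addr0.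
- by move=> s t st s0 Q q qb; rewrite -(perm_big _ st) /= (s0 _ _ qb).
- by move=> m n Q q qb; rewrite !big_cons big_nil addr0 (bilNl qb) subrr.
- move=> m n s s0 Q q qb; have := s0 Q q qb.
  by rewrite !big_cons /= (bilNl qb) addrA subrr add0r.
- move=> a s s0 Q q qb; rewrite big_map.
  under eq_bigr do rewrite (bilZl qb).
  by rewrite -scaler_sumr (s0 _ _ qb) scaler0.
- move=> a m m' n Q q qb; rewrite !big_cons big_nil /= !(bilNl qb) (bilDl qb).
  by rewrite addr0 -opprD subrr.
- move=> a m n n' Q q qb; rewrite !big_cons big_nil /= !(bilNl qb) (bilDr qb).
  by rewrite (bilZl qb) (bilZr qb) addr0 -opprD subrr.
Defined.

Definition tensor := fquot tensor_null_family.
HB.instance Definition _ := GRing.Lmodule.on tensor.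

Definition tclass (s : seq (M * N)) : tensor := fclass tensor_null_family s.

Lemma tclassP s t : tclass s = tclass t <->
  forall (Q : lmodType R) (q : M -> N -> Q), bilinear_map q ->
    \sum_(p <- s) q p.1 p.2 = \sum_(p <- t) q p.1 p.2.
Proof.
have neg (Q : lmodType R) (q : M -> N -> Q) : bilinear_map q ->
    \sum_(p <- s ++ fneg t) q p.1 p.2 =
    \sum_(p <- s) q p.1 p.2 - \sum_(p <- t) q p.1 p.2.
  move=> qb; rewrite big_cat big_map -sumrN /=; congr (_ + _).
  by apply: eq_bigr => p _; rewrite (bilNl qb).
split=> [/fclassP h Q q qb|h].
  by apply/eqP; rewrite -subr_eq0 -neg //; apply/eqP/h.
by apply/fclassP => Q q qb; rewrite neg // h // subrr.
Qed.

Lemma tclass_ind (P : tensor -> Prop) :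
  (forall s, P (tclass s)) -> forall x, P x.
Proof. exact: fquot_ind. Qed.

Section Lift.
Variables (Q : lmodType R) (q : M -> N -> Q).
Hypothesis q_bil : bilinear_map q.

Definition tensor_lift_fun (x : tensor) : Q := \sum_(p <- repr x) q p.1 p.2.

Lemma tensor_lift_funE s : tensor_lift_fun (tclass s) = \sum_(p <- s) q p.1 p.2.
Proof. by have /tclassP := fclass_repr (tclass s); apply. Qed.

Lemma tensor_lift_linear : linear tensor_lift_fun.
Proof.
move=> a; elim/tclass_ind=> s; elim/tclass_ind=> t.
have -> : a *: tclass s = tclass (fscale a s) by exact: fsclE.
rewrite -fclassD !tensor_lift_funE big_cat big_map scaler_sumr; congr (_ + _).
by apply: eq_bigr => p _; rewrite (bilZl q_bil).
Qed.
End Lift.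

Lemma tensor_lift (Q : lmodType R) (q : M -> N -> Q) : bilinear_map q ->
  exists h : {linear tensor -> Q},
    forall s, h (tclass s) = \sum_(p <- s) q p.1 p.2.
Proof.
move=> qb.
pose hL := GRing.isLinear.Build _ _ _ _ _ (tensor_lift_linear qb).
pose h : {linear tensor -> Q} := HB.pack (tensor_lift_fun q) hL.
by exists h => s; apply: tensor_lift_funE.
Qed.

Definition tpure (m : M) (n : N) : tensor := tclass [:: (m, n)].

Lemma tclass_sum s : tclass s = \sum_(p <- s) tpure p.1 p.2.
Proof. exact: fclass_sum. Qed.

Lemma tpure_bilinear : bilinear_map tpure. Proof. exact: fpure_bilinear. Qed.

(** The composite T -> [tensor] -> T fixes pure tensors, so it is the identity by uniqueness in the
    universal property of T; its values are sums of pure tensors. *)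
Lemma tensor_product_span (T : lmodType R) (t : M -> N -> T) :
  is_tensor_product t -> forall z, exists s : seq (M * N),
    z = \sum_(p <- s) t p.1 p.2.
Proof.
move=> [tb tu] z; have [f fE] := tensor_lift tb.
have [g [gE _]] := tu _ _ tpure_bilinear.
have [h [_ hu]] := tu _ _ tb.
have fg m n : (f \o g) (t m n) = t m n by rewrite /= gE fE big_seq1.
exists (repr (g z)); rewrite -fE /tclass fclass_repr.
by rewrite [RHS](hu (f \o g) fg) -(hu (idfun : {linear T -> T})).
Qed.
End Tensor.

(** * Tensor products of algebras *)

Section LRMorphisms.
Variable k : fieldType.

Lemma points_eq (A R : comAlgType k) (f g : points A R) : f =1 g -> f = g.
Proof.
case: f => f [[fa] [fm] [fs]]; case: g => g [[ga] [gm] [gs]] /= /funext fg.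
rewrite fg in fa fm fs *.
by rewrite (Prop_irrelevance fa ga) (Prop_irrelevance fm gm)
  (Prop_irrelevance fs gs).
Qed.

Lemma acompE (A B C : comAlgType k) (f : points A B) (x : points B C) a :
  acomp f x a = x (f a).
Proof. by []. Qed.

Lemma acompA (A B C D : comAlgType k) (f : points A B) (g : points B C)
  (h : points C D) : acomp f (acomp g h) = acomp (acomp f g) h.
Proof. exact: points_eq. Qed.

Lemma acomp1 (A B : comAlgType k) (f : points A B) :
  acomp f (idfun : points B B) = f.
Proof. exact: points_eq. Qed.

Lemma comp1a (A B : comAlgType k) (f : points A B) :
  acomp (idfun : points A A) f = f.
Proof. exact: points_eq. Qed.

Lemma point_of (A R : comAlgType k) (f : A -> R) :
  linear f -> {morph f : a b / a * b} -> f 1 = 1 ->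
  exists x : points A R, x =1 f.
Proof.
move=> fL fM f1.
pose iL := GRing.isLinear.Build _ _ _ _ f fL.
pose iM := GRing.isMonoidMorphism.Build _ _ f (conj f1 fM).
by exists (HB.pack f iL iM : points A R).
Qed.
End LRMorphisms.

Section AlgTensor.
Variables (k : fieldType) (A B : comAlgType k).

Definition atensor : Type := @tensor k A B.
HB.instance Definition _ := GRing.Lmodule.on atensor.

Definition cls (s : seq (A * B)) : atensor := @tclass k A B s.

Lemma cls_ind (P : atensor -> Prop) : (forall s, P (cls s)) -> forall x, P x.
Proof. exact: fquot_ind. Qed.

Definition lmul (s t : seq (A * B)) : seq (A * B) :=
  [seq (p.1 * r.1, p.2 * r.2) | p <- s, r <- t].

Definition amul (x y : atensor) : atensor := cls (lmul (repr x) (repr y)).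

Lemma sum_lmul (V : zmodType) (q : A -> B -> V) s t :
  \sum_(p <- lmul s t) q p.1 p.2 =
  \sum_(p <- s) \sum_(r <- t) q (p.1 * r.1) (p.2 * r.2).
Proof. by rewrite big_allpairs_dep. Qed.

Lemma bil_mul (Q : lmodType k) (q : A -> B -> Q) a b : bilinear_map q ->
  bilinear_map (fun x y => q (x * a) (y * b)).
Proof.
move=> qb; split=> [m c n n'|n c m m'].
  by rewrite mulrDl -scalerAl (bilDr qb) (bilZr qb).
by rewrite mulrDl -scalerAl (bilDl qb) (bilZl qb).
Qed.

(** Multiplication by a fixed pair of [t] turns [q] into another bilinear map, which agrees on [s]
    and [s']. With [sum_lmulC] this makes the product well defined in both factors. *)
Lemma sum_lmul_eq (Q : lmodType k) (q : A -> B -> Q) s s' t :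
  bilinear_map q -> cls s = cls s' ->
  \sum_(p <- lmul s t) q p.1 p.2 = \sum_(p <- lmul s' t) q p.1 p.2.
Proof.
move=> qb /tclassP ss'; rewrite !sum_lmul exchange_big /= [RHS]exchange_big /=.
by apply: eq_bigr => r _; apply: (ss' _ (fun x y => q (x * _) (y * _)));
  apply: bil_mul.
Qed.

Lemma sum_lmulC (V : zmodType) (q : A -> B -> V) s t :
  \sum_(p <- lmul s t) q p.1 p.2 = \sum_(p <- lmul t s) q p.1 p.2.
Proof.
rewrite !sum_lmul exchange_big /=.
by do 2!apply: eq_bigr => ? _; rewrite mulrC [X in q _ X]mulrC.
Qed.

Lemma cls_repr x : cls (repr x) = x. Proof. exact: fclass_repr. Qed.

Lemma amulE s t : amul (cls s) (cls t) = cls (lmul s t).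
Proof.
apply/tclassP => Q q qb.
rewrite (sum_lmul_eq _ qb (cls_repr _)) sum_lmulC.
by rewrite (sum_lmul_eq _ qb (cls_repr _)) sum_lmulC.
Qed.

Fact amulC : commutative amul.
Proof.
elim/cls_ind=> s; elim/cls_ind=> t; rewrite !amulE.
by apply/tclassP => Q q qb; apply: sum_lmulC.
Qed.

Fact amulA : associative amul.
Proof.
elim/cls_ind=> s; elim/cls_ind=> t; elim/cls_ind=> u.
rewrite (amulE t u) (amulE s t) (amulE s) (amulE _ u); apply/tclassP => Q q qb.
rewrite !sum_lmul (sum_lmul (fun a b => \sum_(r <- u) q (a * r.1) (b * r.2))).
apply: eq_bigr => p _.
rewrite (sum_lmul (fun a b => q (p.1 * a) (p.2 * b))).
by apply: eq_bigr => r _; apply: eq_bigr => v _; rewrite !mulrA.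
Qed.

Fact amul1 : left_id (cls [:: (1, 1)]) amul.
Proof.
elim/cls_ind=> s; rewrite amulE; apply/tclassP => Q q qb.
by rewrite sum_lmul big_seq1; apply: eq_bigr => p _; rewrite !mul1r.
Qed.

Fact amulDl : left_distributive amul +%R.
Proof.
elim/cls_ind=> s; elim/cls_ind=> t; elim/cls_ind=> u.
rewrite -[_ + _]fclassD !amulE -[RHS]fclassD.
by congr (cls _); exact: allpairs_cat.
Qed.

(** A functional on B with value 1 at 1 gives a bilinear map to A that sends the unit to 1. *)
Lemma atensor_unit_neq0 : cls [:: (1, 1)] != 0.
Proof.
apply/eqP => /fclass0P h.
have [phi phi1] := functional_neq0 (elimN eqP (oner_neq0 B)).
have := h A (fun a b => phi b *: a); rewrite big_seq1 /= phi1 scale1r.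
case/(_ _)/eqP/idPn; last exact: oner_neq0.
split=> [a c b b'|b c a a']; first by rewrite linearP scalerDl scalerA.
by rewrite scalerDr !scalerA mulrC.
Qed.

HB.instance Definition _ := GRing.Zmodule_isComNzRing.Build atensor
  amulA amulC amul1 amulDl atensor_unit_neq0.

Fact ascaleAl (c : k) (x y : atensor) : c *: (x * y) = (c *: x) * y.
Proof.
elim/cls_ind: x => s; elim/cls_ind: y => t.
have sE u : c *: cls u = cls (fscale c u) by exact: fsclE.
rewrite [_ * _]amulE !sE [RHS]amulE; apply/tclassP => Q q qb.
rewrite big_map !sum_lmul big_map.
under eq_bigr do rewrite (bilZl qb).
rewrite -scaler_sumr sum_lmul scaler_sumr; apply: eq_bigr => p _.
by rewrite scaler_sumr; apply: eq_bigr => r _; rewrite -scalerAl (bilZl qb).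
Qed.

HB.instance Definition _ := GRing.Lmodule_isLalgebra.Build k atensor ascaleAl.
HB.instance Definition _ := GRing.Lalgebra_isComAlgebra.Build k atensor.
End AlgTensor.

Section TensorInterface.
Variable k : fieldType.
Implicit Types A B C R : comAlgType k.

Lemma mul_bilinear A B R (x : points A R) (y : points B R) :
  bilinear_map (fun a b => x a * y b).
Proof.
split=> [a c b b'|b c a a']; rewrite linearP.
  by rewrite mulrDr scalerAr.
by rewrite mulrDl scalerAl.
Qed.

(** The interface to A (x) B used from here on: T is spanned by products, (i, j) is the universal
    pair of points, and a list that sums to zero in T is killed by every bilinear map. *)
Lemma tensor_algebra A B :
  exists (T : comAlgType k) (i : points A T) (j : points B T),
  [/\ forall z, exists s : seq (A * B), z = \sum_(p <- s) i p.1 * j p.2,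
      forall R (x : points A R) (y : points B R),
        exists u : points T R, acomp i u = x /\ acomp j u = y
    & forall (Q : lmodType k) (q : A -> B -> Q) s, bilinear_map q ->
        \sum_(p <- s) i p.1 * j p.2 = 0 -> \sum_(p <- s) q p.1 p.2 = 0].
Proof.
pose T : comAlgType k := atensor A B.
have pureM a b a' b' :
    (cls [:: (a, b)] : T) * cls [:: (a', b')] = cls [:: (a * a', b * b')].
  exact: amulE.
have tb : bilinear_map (fun a b => cls [:: (a, b)] : T).
  exact: (@tpure_bilinear k A B).
have [|||i iE] := @point_of k A T (fun a => cls [:: (a, 1)]).
- by move=> c a a'; rewrite (bilDl tb) (bilZl tb).
- by move=> a a'; rewrite pureM mulr1.
- by [].
have [|||j jE] := @point_of k B T (fun b => cls [:: (1, b)]).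
- by move=> c a a'; rewrite (bilDr tb) (bilZr tb).
- by move=> a a'; rewrite pureM mulr1.
- by [].
have ijE s : \sum_(p <- s) i p.1 * j p.2 = cls s :> T.
  rewrite [RHS]tclass_sum; apply: eq_bigr => p _.
  by rewrite iE jE pureM mulr1 mul1r.
exists T, i, j; split.
- by elim/cls_ind=> s; exists s; rewrite ijE.
- move=> R x y.
  have [h hE] := tensor_lift (mul_bilinear x y).
  have [|||u uE] := @point_of k T R h.
  + exact: linearP.
  + elim/cls_ind=> s; elim/cls_ind=> t; rewrite [_ * _]amulE !hE.
    rewrite (sum_lmul (fun a b => x a * y b)) mulr_suml.
    apply: eq_bigr => p _; rewrite mulr_sumr.
    by apply: eq_bigr => r _; rewrite !rmorphM mulrACA.
  + by rewrite hE big_seq1 !rmorph1 mulr1.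
  exists u; split; apply: points_eq => a; rewrite /acomp /= uE ?iE ?jE hE.
    by rewrite big_seq1 rmorph1 mulr1.
  by rewrite big_seq1 rmorph1 mul1r.
- move=> Q q s qb; rewrite ijE => s0.
  have [h hE] := tensor_lift qb.
  by rewrite -hE [tclass s]s0 linear0.
Qed.

(* [tzero s] says that the sum of the [a (x) b], for [(a, b)] in [s], vanishes
   in A (x) B. *)
Definition tzero A B (s : seq (A * B)) : Prop :=
  forall R (x : points A R) (y : points B R), \sum_(p <- s) x p.1 * y p.2 = 0.

(** Points detect zero because the universal pair of points is among them. *)
Lemma tzero_bilinear A B (s : seq (A * B)) (Q : lmodType k) (q : A -> B -> Q) :
  tzero s -> bilinear_map q -> \sum_(p <- s) q p.1 p.2 = 0.
Proof.
move=> s0 qb; have [T [i [j [_ _ h]]]] := tensor_algebra A B.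
by apply: h qb _; apply: s0.
Qed.

Lemma slicel_bilinear (V W : lmodType k) (phi : {scalar V}) :
  bilinear_map (fun (v : V) (w : W) => phi v *: w).
Proof.
split=> [a c b b'|b c a a']; first by rewrite scalerDr !scalerA mulrC.
by rewrite linearP scalerDl scalerA.
Qed.

Lemma slicer_bilinear (V W : lmodType k) (psi : {scalar W}) :
  bilinear_map (fun (v : V) (w : W) => psi w *: v).
Proof.
split=> [a c b b'|b c a a']; first by rewrite linearP scalerDl scalerA.
by rewrite scalerDr !scalerA mulrC.
Qed.

Lemma tzero_slicel A B (s : seq (A * B)) (phi : {scalar A}) :
  tzero s -> \sum_(p <- s) phi p.1 *: p.2 = 0.
Proof. by move=> s0; apply: tzero_bilinear s0 (slicel_bilinear _ phi). Qed.

Lemma tzero_slicer A B (s : seq (A * B)) (psi : {scalar B}) :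
  tzero s -> \sum_(p <- s) psi p.2 *: p.1 = 0.
Proof. by move=> s0; apply: tzero_bilinear s0 (slicer_bilinear _ psi). Qed.

(** Yoneda: the value of F at the universal pair is a sum of products in A (x) B, and naturality
    carries this expression to every pair of points. *)
Lemma natural_expr A B C
    (F : forall R, points A R -> points B R -> points C R) :
  (forall R S (phi : points R S) x y,
     acomp (F R x y) phi = F S (acomp x phi) (acomp y phi)) ->
  forall c, exists s : seq (A * B), forall R x y,
    F R x y c = \sum_(p <- s) x p.1 * y p.2.
Proof.
move=> Fnat c; have [T [i [j [span pair _]]]] := tensor_algebra A B.
have [s sE] := span (F T i j c); exists s => R x y.
have [u [<- <-]] := pair R x y.
rewrite -Fnat acompE sE rmorph_sum; apply: eq_bigr => p _.
by rewrite rmorphM.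
Qed.

End TensorInterface.

(** Independence is stated so that its failure is exactly the input of [tensor_shorten]. The
    functional dual to [e i] separates it from the span of the others. *)
Lemma dual_family (k : fieldType) (V : lmodType k) n (e : 'I_n -> V) :
  (forall i : 'I_n, ~ exists c : 'I_n.-1 -> k,
     e i = \sum_j c j *: e (lift i j)) ->
  exists phi : 'I_n -> {scalar V}, forall i j, phi i (e j) = (i == j)%:R.
Proof.
case: n e => [|n] e indep; first by exists (fun=> \0) => -[].
have phiP i : exists phi : {scalar V}, forall j, phi (e j) = (i == j)%:R.
  have [||phi [phi1 phi0]] := @functional_sep k V
    (fun v => exists c : 'I_n -> k, v = \sum_j c j *: e (lift i j)) (e i).
  - split; first by exists (fun=> 0); rewrite big1 // => j _; rewrite scale0r.
    move=> a u v [c ->] [c' ->]; exists (fun j => a * c j + c' j).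
    rewrite scaler_sumr -big_split; apply: eq_bigr => j _.
    by rewrite scalerDl scalerA.
  - exact: indep.
  exists phi => j; case: (unliftP i j) => [l ->|->]; last by rewrite eqxx.
  rewrite (negPf (neq_lift _ _)) phi0 //.
  exists (fun m => (m == l)%:R); rewrite (bigD1 l) //= eqxx scale1r big1 ?addr0 //.
  by move=> m /negPf ->; rewrite scale0r.
by exists (fun i => projT1 (cid (phiP i))) => i j; case: cid.
Qed.
Lemma tensor_shorten (k : fieldType) (V W Q : lmodType k) n (e : 'I_n -> V)
    (w : 'I_n -> W) (i : 'I_n) (c : 'I_n.-1 -> k) (q : V -> W -> Q) :
  bilinear_map q -> e i = \sum_j c j *: e (lift i j) ->
  \sum_j q (e j) (w j) =
  \sum_(j < n.-1) q (e (lift i j)) (w (lift i j) + c j *: w i).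
Proof.
move=> qb ei; rewrite (bigD1_ord i) //= ei (bil_suml qb) -big_split /=.
by apply: eq_bigr => j _; rewrite (bilZl qb) (bilDr qb) (bilZr qb) addrC.
Qed.

(** A dependence on either side removes a term, so the process stops at families independent on both
    sides. Slicing by [phi i] then returns [w i], and slicing by [psi i] returns [e i]. *)
Lemma tensor_reduce (k : fieldType) (V W : lmodType k) (s : seq (V * W)) :
  exists n (e : 'I_n -> V) (w : 'I_n -> W),
  [/\ forall (Q : lmodType k) (q : V -> W -> Q), bilinear_map q ->
        \sum_(p <- s) q p.1 p.2 = \sum_i q (e i) (w i),
      exists phi : 'I_n -> {scalar V}, forall i j, phi i (e j) = (i == j)%:R
    & exists psi : 'I_n -> {scalar W}, forall i j, psi i (w j) = (i == j)%:R].
Proof.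
suff H n (e : 'I_n -> V) (w : 'I_n -> W) : exists n (e' : 'I_n -> V) (w' : 'I_n -> W),
  [/\ forall (Q : lmodType k) (q : V -> W -> Q), bilinear_map q ->
        \sum_i q (e i) (w i) = \sum_i q (e' i) (w' i),
      exists phi : 'I_n -> {scalar V}, forall i j, phi i (e' j) = (i == j)%:R
    & exists psi : 'I_n -> {scalar W}, forall i j, psi i (w' j) = (i == j)%:R].
  have [m [e [w [h h1 h2]]]] := H _ (fun i => (tnth (in_tuple s) i).1)
    (fun i => (tnth (in_tuple s) i).2).
  exists m, e, w; split=> // Q q qb; rewrite -h // -[s in LHS]/(val (in_tuple s)).
  by rewrite big_tuple.
elim/ltn_ind: n e w => n IHn e w.
have [[i [c ei]]|e_ind] := pselect (exists i (c : 'I_n.-1 -> k),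
    e i = \sum_j c j *: e (lift i j)).
  have n_gt0 : (n.-1 < n)%N by case: (n) i {c ei} => // -[].
  have [m [e' [w' [h ? ?]]]] := IHn _ n_gt0 (fun j => e (lift i j))
    (fun j => w (lift i j) + c j *: w i).
  by exists m, e', w'; split=> // Q q qb; rewrite (tensor_shorten w qb ei) h.
have [[i [c wi]]|w_ind] := pselect (exists i (c : 'I_n.-1 -> k),
    w i = \sum_j c j *: w (lift i j)).
  have n_gt0 : (n.-1 < n)%N by case: (n) i {c wi} => // -[].
  have [m [e' [w' [h ? ?]]]] := IHn _ n_gt0
    (fun j => e (lift i j) + c j *: e i) (fun j => w (lift i j)).
  exists m, e', w'; split=> // Q q qb; rewrite -h //.
  by apply: (@tensor_shorten _ _ _ _ _ w e i c (fun b a => q a b)) wi; case: qb.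
exists n, e, w; split=> //; apply: dual_family => i [c ec].
  by apply: e_ind; exists i, c.
by apply: w_ind; exists i, c.
Qed.

(** This is the injectivity of f (x) g. A reduced list has dual functionals on A; each of them is
    matched by a functional on A1, which isolates one term. *)
Lemma tzero_inj (k : fieldType) (A B A1 B1 : comAlgType k) (f : points A A1)
    (g : points B B1) (s : seq (A * B)) :
  injective f -> injective g ->
  tzero [seq (f p.1, g p.2) | p <- s] -> tzero s.
Proof.
move=> f_inj g_inj s0 R x y.
have [n [e [w [sE [phi phiE] _]]]] := tensor_reduce s.
rewrite (sE _ _ (mul_bilinear x y)) big1 // => i _.
suff -> : w i = 0 by rewrite rmorph0 mulr0.
apply: g_inj; rewrite rmorph0.
(* [Phi] is 1 at f (e i) and kills f (ker phi i), which contains the other f (e j); slicing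
   therefore leaves g (w i) = 0. *)
have [||Phi [Phi1 Phi0]] := @functional_sep k A1
  (fun a1 => exists a, a1 = f a /\ phi i a = 0) (f (e i)).
- split; first by exists 0; rewrite !linear0.
  move=> c u v [a [-> a0]] [b [-> b0]]; exists (c *: a + b).
  by rewrite !linearP /= a0 b0 mulr0 addr0.
- move=> [a [/f_inj <-]]; rewrite phiE eqxx => /eqP.
  by rewrite (negPf (oner_neq0 _)).
have := tzero_slicel Phi s0; rewrite big_map /=.
have qb : bilinear_map (fun a b => Phi (f a) *: g b).
  split=> [a c b b'|b c a a']; first by rewrite linearP scalerDr !scalerA mulrC.
  by rewrite !linearP scalerDl scalerA.
rewrite (sE _ _ qb) (bigD1 i) //= Phi1 scale1r big1 ?addr0 // => j ji.
by rewrite Phi0 ?scale0r //; exists (e j); rewrite phiE eq_sym (negPf ji).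
Qed.

(** * The equational criterion of flatness *)

Lemma perm_map_lift (S T : eqType) (f : S -> T) s t :
  perm_eq (map f s) t -> exists2 s', perm_eq s s' & t = map f s'.
Proof.
elim: t s => [|x t IHt] s st.
  by exists s => //; move: st => /perm_size/size0nil ->.
have /mapP[y ys xy] : x \in map f s by rewrite (perm_mem st) mem_head.
have [|s' ss' ->] := IHt (rem y s).
  rewrite -(perm_cons x); apply: perm_trans st.
  by rewrite xy -map_cons perm_sym perm_map // perm_to_rem.
exists (y :: s'); last by rewrite xy.
by rewrite (perm_trans (perm_to_rem ys)) // perm_cons.
Qed.

(** The equational criterion: every linear relation in N comes from relations in R. *)
Definition eq_flat (R : comNzRingType) (N : lmodType R) : Prop :=
  forall n (a : 'I_n -> R) (g : 'I_n -> N), \sum_i a i *: g i = 0 ->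
  exists m (c : 'M[R]_(n, m)) (y : 'I_m -> N),
    (forall i, g i = \sum_j c i j *: y j) /\ forall j, \sum_i a i * c i j = 0.

Section EqFlat.
Variables (R : comNzRingType) (N : lmodType R).
Hypothesis N_flat : eq_flat N.

Definition lincomb m (y : 'I_m -> N) (r : 'rV[R]_m) : N :=
  \sum_j r 0 j *: y j.

Section Vanishing.
Variable M : lmodType R.

(* Flatness of N makes these formal sums closed under cancellation, so that
   they are exactly those that vanish in M (x) N. *)
Definition vanishing (s : seq (M * N)) : Prop :=
  exists m (y : 'I_m -> N) (s' : seq (M * 'rV[R]_m)),
    s = [seq (p.1, lincomb y p.2) | p <- s'] /\
    forall j, \sum_(p <- s') p.2 0 j *: p.1 = 0.

Lemma lincomb_row_mx m1 m2 (y1 : 'I_m1 -> N) (y2 : 'I_m2 -> N) r1 r2 :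
  lincomb (fun i => match split i with inl i => y1 i | inr i => y2 i end)
    (row_mx r1 r2) = lincomb y1 r1 + lincomb y2 r2.
Proof.
rewrite /lincomb big_split_ord; congr (_ + _); apply: eq_bigr => i _.
  by rewrite row_mxEl -[lshift _ _]/(unsplit (inl i)) unsplitK.
by rewrite row_mxEr -[rshift _ _]/(unsplit (inr i)) unsplitK.
Qed.

Lemma lincomb0 m (y : 'I_m -> N) : lincomb y 0 = 0.
Proof. by rewrite /lincomb big1 // => i _; rewrite mxE scale0r. Qed.

Lemma vanishing_cat s t : vanishing s -> vanishing t -> vanishing (s ++ t).
Proof.
move=> [m1 [y1 [s1 [-> s10]]]] [m2 [y2 [s2 [-> s20]]]].
exists (m1 + m2)%N, (fun i => match split i with inl i => y1 i | inr i => y2 i end).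
exists ([seq (p.1, row_mx p.2 0) | p <- s1] ++ [seq (p.1, row_mx 0 p.2) | p <- s2]).
split.
  rewrite map_cat -!map_comp; congr (_ ++ _); apply: eq_map => p /=.
    by rewrite lincomb_row_mx lincomb0 addr0.
  by rewrite lincomb_row_mx lincomb0 add0r.
move=> j; rewrite big_cat !big_map /= -[j]splitK.
case: (split j) => i /=.
  under eq_bigr do rewrite row_mxEl.
  rewrite s10 add0r big1 // => p _.
  by rewrite row_mxEl mxE scale0r.
rewrite addrC.
under eq_bigr do rewrite row_mxEr.
rewrite s20 add0r big1 // => p _.
by rewrite row_mxEr mxE scale0r.
Qed.

Lemma vanishing_perm s t : perm_eq s t -> vanishing s -> vanishing t.
Proof.
move=> st [m [y [s' [sE s'0]]]]; move: st; rewrite sE => /perm_map_lift[t' st ->].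
by exists m, y, t'; split=> // j; rewrite -(perm_big _ st).
Qed.

(** The two occurrences of n may be written with different rows r1 and r2. Flatness applied to r1 -
    r2 refines [y] by a matrix c with r1 c = r2 c, after which the two terms cancel. *)
Lemma vanishing_cancel m n s : vanishing [:: (m, n), (- m, n) & s] -> vanishing s.
Proof.
move=> [l [y [[|[m1 r1] [|[m2 r2] s']] [//= sE s'0]]]].
case: sE => mE nE mE' nE' ->; subst m1 m2.
have [|l' [c [y' [yE cE]]]] := N_flat (a := fun i => (r1 - r2) 0 i) (g := y).
  rewrite -[LHS]/(lincomb y (r1 - r2)); apply/eqP.
  rewrite /lincomb; under eq_bigr do rewrite !mxE scalerBl.
  by rewrite sumrB subr_eq0 -!/(lincomb _ _) -nE -nE'.
have r12 : r1 *m c = r2 *m c.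
  by apply/subr0_eq/rowP => j; rewrite -mulmxBl !mxE cE.
exists l', y', [seq (p.1, p.2 *m c) | p <- s']; split.
  rewrite -map_comp; apply: eq_map => p /=; congr (_, _).
  rewrite /lincomb; under eq_bigr do rewrite yE scaler_sumr.
  rewrite exchange_big; apply: eq_bigr => j _; rewrite mxE scaler_suml.
  by apply: eq_bigr => i _; rewrite scalerA.
move=> j.
have : \sum_(p <- [:: (m, r1), (- m, r2) & s']) (p.2 *m c) 0 j *: p.1 = 0.
  under eq_bigr do rewrite mxE scaler_suml.
  rewrite exchange_big big1 //= => i _.
  under eq_bigr do rewrite mulrC -scalerA.
  by rewrite -scaler_sumr s'0 scaler0.
by rewrite !big_cons /= r12 scalerN addNKr big_map.
Qed.

Fact vanishing_family : null_family M N.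
Proof.
exists vanishing.
- exact: vanishing_cat.
- exact: vanishing_perm.
- move=> m n; exists 1, (fun=> n), [:: (m, 1); (- m, 1)]; split=> [|j].
    by rewrite /= /lincomb big_ord1 mxE scale1r.
  by rewrite !big_cons big_nil /= addr0 ord1 mxE !scale1r subrr.
- exact: vanishing_cancel.
- move=> a s [m [y [s' [-> s'0]]]].
  exists m, y, [seq (a *: p.1, p.2) | p <- s']; split=> [|j].
    by rewrite /fscale -!map_comp.
  rewrite big_map; under eq_bigr do rewrite scalerA mulrC -scalerA.
  by rewrite -scaler_sumr s'0 scaler0.
- move=> a m m' n.
  exists 1, (fun=> n), [:: (a *: m + m', 1); (- (a *: m), 1); (- m', 1)].
  split=> [|j]; first by rewrite /= /lincomb big_ord1 mxE scale1r.
  by rewrite !big_cons big_nil /= addr0 ord1 mxE !scale1r -opprD subrr.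
- move=> a m n n'.
  pose y (i : 'I_2) := if i == 0 then n else n'.
  pose r (b c : R) : 'rV_2 := \row_j if j == 0 then b else c.
  have yr b c : lincomb y (r b c) = b *: n + c *: n'.
    by rewrite /lincomb big_ord_recl big_ord1 /y !mxE.
  exists 2, y, [:: (m, r a 1); (- (a *: m), r 1 0); (- m, r 0 1)].
  split=> [|j]; first by rewrite /= !yr !scale1r !scale0r addr0 add0r.
  rewrite !big_cons big_nil /= addr0 !mxE.
  by case: ifP => _; rewrite !scale1r ?scale0r ?addr0 ?add0r subrr.
Defined.
End Vanishing.

Lemma flat_module_eq_flat : flat_module N.
Proof.
move=> M M' u u_inj T T' t t' tT tT' h hE x y hxy.
have [tb _] := tT; have [t'b t'u] := tT'.
suff h0 z : h z = 0 -> z = 0.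
  by apply/subr0_eq/h0; rewrite linearB hxy subrr.
have [s ->] := tensor_product_span tT z.
rewrite linear_sum => s0.
(* Mapping T' to the quotient by vanishing sums turns h z = 0 into an equational reason for the
   vanishing of the list of u m, n. *)
have [f [fE _]] := t'u _ _ (fpure_bilinear (vanishing_family M')).
have : vanishing_family M' [seq (u p.1, p.2) | p <- s].
  apply/fclass0P; rewrite fclass_sum big_map -[RHS](linear0 f) -s0 linear_sum.
  by apply: eq_bigr => p _; rewrite hE fE.
move=> [m [w [s' [sE s'0]]]].
(* [sE] matches [s'] with [s] entry by entry; [c] keeps the rows, so that they can be attached to
   elements of M instead of their images under [u]. *)
have [c sc] : exists c : seq 'rV[R]_m, s' = zip (map (u \o fst) s) c /\ size c = size s.
  exists (map snd s').
  have eq1 : map (u \o fst) s = map fst s'.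
    by have := congr1 (map fst) sE; rewrite -!map_comp => ->; apply: eq_map.
  rewrite eq1 zip_unzip !size_map; split=> //.
  by have := congr1 size sE; rewrite !size_map.
pose r := zip s c.
have rs : map fst r = s by rewrite -/unzip1 unzip1_zip // sc.2.
have rs' : map (fun p => (u p.1.1, p.2)) r = s'.
  rewrite sc.1 /r; elim: (s) (c) => [|[a b] s1 IH] [|c1 cs] //=.
  by rewrite IH.
have rw p : p \in r -> p.1.2 = lincomb w p.2.
  move: sE; rewrite -rs' -{1}rs -!map_comp => /eq_in_map h' /h'.
  by case.
rewrite -rs big_map big_seq.
under eq_bigr => p pr do rewrite (rw p pr) (bil_sumr tb).
rewrite -big_seq exchange_big big1 //= => j _.
under eq_bigr do rewrite (bilZr tb) -(bilZl tb).
rewrite -(bil_suml tb) -[RHS](bil0l tb (w j)); congr t.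
apply: u_inj; rewrite linear0 linear_sum -[RHS](s'0 j) -rs' big_map.
by apply: eq_bigr => p _; rewrite linearZ.
Qed.
End EqFlat.

(** * Modules of relations whose minors generate the unit ideal *)

(** Right multiplication by [T], of determinant det M, makes the block matrix upper triangular;
    regularity then cancels det M. *)
Lemma det_schur_regular (R : comNzRingType) r (x : 'M[R]_1) (y : 'rV[R]_r)
    (z : 'cV[R]_r) (M : 'M[R]_r) :
  GRing.rreg (\det M) ->
  \det (block_mx x y z M) = x 0 0 * \det M - (y *m \adj M *m z) 0 0.
Proof.
move=> M_reg; apply: M_reg.
pose T := block_mx ((\det M)%:M : 'M_1) 0 (- (\adj M *m z)) 1%:M.
have detT : \det T = \det M by rewrite /T det_lblock det1 mulr1 det_scalar1.
rewrite -[X in _ * X = _]detT -det_mulmx /T mulmx_block !mulmx0 !mulmx1 !add0r.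
rewrite !mulmxN !mulmxA mul_mx_adj !mul_mx_scalar mul_scalar_mx subrr.
rewrite det_ublock det_mx11 !mxE; congr ((_ - _) * _); exact: mulrC.
Qed.

(** M is deformed to M + X over R[X], the characteristic matrix of -M, whose determinant is monic
    and hence regular; the identity is then evaluated at X = 0. *)
Lemma det_schur (R : comNzRingType) r (x : 'M[R]_1) (y : 'rV[R]_r)
    (z : 'cV[R]_r) (M : 'M[R]_r) :
  \det (block_mx x y z M) = x 0 0 * \det M - (y *m \adj M *m z) 0 0.
Proof.
pose h : {rmorphism {poly R} -> R} := horner_eval 0.
have hC m n (N : 'M[R]_(m, n)) : map_mx h (map_mx polyC N) = N.
  by apply/matrixP => i j; rewrite !mxE /h /= /horner_eval hornerC.
have hM : map_mx h (char_poly_mx (- M)) = M.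
  apply/matrixP => i j; rewrite !mxE /h /= /horner_eval hornerD hornerN hornerC.
  by rewrite hornerMn hornerX mul0rn add0r opprK.
have /(det_schur_regular (map_mx polyC x) (map_mx polyC y) (map_mx polyC z)) :
    GRing.rreg (\det (char_poly_mx (- M))).
  exact/monic_rreg/char_poly_monic.
move/(congr1 h); rewrite -det_map_mx map_block_mx !hC hM => ->.
rewrite rmorphB rmorphM /= -det_map_mx hM; congr (_ * _ - _).
  by rewrite mxE /h /= /horner_eval hornerC.
have -> (N : 'M[{poly R}]_1) : h (N 0 0) = (map_mx h N) 0 0 by rewrite mxE.
by rewrite !map_mxM map_mx_adj hM !hC.
Qed.

(** Multilinearity in the rows; used once on rows and once on columns, it takes the place of the
    Cauchy-Binet formula. *)
Lemma det_spanned (R : comNzRingType) r (S L : R -> Prop) (U : 'rV[R]_r -> Prop) :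
  L 0 -> (forall u v, L u -> L v -> L (u + v)) ->
  (forall a u, S a -> L u -> L (a * u)) ->
  (forall M : 'M_r, (forall i, U (row i M)) -> L (\det M)) ->
  forall M : 'M_r,
    (forall i, exists s : seq (R * 'rV_r),
      (forall p, p \in s -> S p.1 /\ U p.2) /\
      row i M = \sum_(p <- s) p.1 *: p.2) ->
  L (\det M).
Proof.
move=> L0 LD LS LU.
(* Rows of index below j are still combinations of elements of U, the others already lie in U; each
   step expands row j. *)
suff H j : forall M : 'M_r,
    (forall i : 'I_r, (i < j)%N -> exists s : seq (R * 'rV_r),
      (forall p, p \in s -> S p.1 /\ U p.2) /\
      row i M = \sum_(p <- s) p.1 *: p.2) ->
    (forall i : 'I_r, (j <= i)%N -> U (row i M)) -> L (\det M).
  by move=> M h; apply: (H r) => // i; rewrite leqNgt ltn_ord.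
elim: j => [|j IHj] M hlt hge; first by apply: LU => i; apply: hge.
have [jr|rj] := ltnP j r; last first.
  apply: IHj => i ij; first by apply: hlt; apply: ltnW.
  by have := leq_trans rj ij; rewrite leqNgt ltn_ord.
pose j0 := Ordinal jr.
pose rep (v : 'rV_r) : 'M_r := \matrix_i (if i == j0 then v else row i M).
have rep_row v i : row i (rep v) = if i == j0 then v else row i M.
  by rewrite rowK.
have rep_det a v w : \det (rep (a *: v + w)) = a * \det (rep v) + \det (rep w).
  have rep' v1 v2 : row' j0 (rep v1) = row' j0 (rep v2).
    by apply/matrixP => i l; rewrite !mxE eq_sym (negPf (neq_lift _ _)).
  rewrite (@determinant_multilinear _ _ _ (rep v) (rep w) j0 a 1) ?mul1r //.
  by rewrite !rep_row eqxx scale1r.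
have [s [sSU sE]] := hlt j0 (ltnSn j).
have -> : M = rep (\sum_(p <- s) p.1 *: p.2).
  by apply/row_matrixP => i; rewrite rep_row -sE; case: eqP => // ->.
elim: s sSU {sE} => [|[a v] s IHs] sSU.
  (* The empty combination gives a zero row, whose determinant vanishes by linearity with
     coefficient -1. *)
  have := rep_det (-1) 0 0; rewrite scaler0 addr0 mulN1r addNr => det0.
  by rewrite big_nil det0.
rewrite big_cons rep_det; apply: LD; last first.
  by apply: IHs => p ps; apply: sSU; rewrite inE ps orbT.
have [/= Sa Uv] := sSU _ (mem_head _ _); apply: LS => //.
apply: IHj => i ij.
  have [|s' s'E] := hlt i; first exact: ltnW.
  by exists s'; rewrite rep_row; case: eqP => // ij0; rewrite ij0 ltnn in ij.
rewrite rep_row; case: eqP => // /eqP ij0; apply: hge.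
by rewrite ltn_neqAle eq_sym ij0.
Qed.

Definition subring_prop (B : nzRingType) (A : B -> Prop) : Prop :=
  [/\ A 1, forall x y, A x -> A y -> A (x - y) &
      forall x y, A x -> A y -> A (x * y)].

Section SubringProp.
Variables (B : comNzRingType) (A : B -> Prop).
Hypothesis A_sub : subring_prop A.

Lemma subring1 : A 1. Proof. by case: A_sub. Qed.

Lemma subringB x y : A x -> A y -> A (x - y).
Proof. by case: A_sub => _ + _; apply. Qed.

Lemma subringM x y : A x -> A y -> A (x * y).
Proof. by case: A_sub => _ _; apply. Qed.

Lemma subring0 : A 0.
Proof. by rewrite -(subrr 1); apply: subringB subring1 subring1. Qed.

Lemma subringN x : A x -> A (- x).
Proof. by rewrite -sub0r; apply: subringB subring0. Qed.

Lemma subringD x y : A x -> A y -> A (x + y).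
Proof. by move=> Ax Ay; rewrite -[y]opprK; apply: subringB => //; apply: subringN. Qed.

Lemma subring_sum (I : Type) (s : seq I) (P : pred I) (F : I -> B) :
  (forall i, P i -> A (F i)) -> A (\sum_(i <- s | P i) F i).
Proof. by move=> AF; apply: (big_ind A subring0 subringD). Qed.

Lemma subring_prod (I : Type) (s : seq I) (P : pred I) (F : I -> B) :
  (forall i, P i -> A (F i)) -> A (\prod_(i <- s | P i) F i).
Proof. by move=> AF; apply: (big_ind A subring1 subringM). Qed.

Lemma subring_sign n : A ((-1) ^+ n).
Proof.
by elim: n => [|n IHn]; [exact: subring1|rewrite exprS mulN1r; apply: subringN].
Qed.

Lemma subring_det n (M : 'M[B]_n) : (forall i j, A (M i j)) -> A (\det M).
Proof.
move=> AM; apply: subring_sum => s _; apply: subringM; first exact: subring_sign.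
by apply: subring_prod => i _.
Qed.

Lemma subring_adj n (M : 'M[B]_n) : (forall i j, A (M i j)) ->
  forall i j, A (\adj M i j).
Proof.
move=> AM i j; rewrite mxE; apply: subringM; first exact: subring_sign.
by apply: subring_det => i' j'; rewrite !mxE.
Qed.

Lemma subring_mulmx m n p (M : 'M[B]_(m, n)) (N : 'M[B]_(n, p)) :
  (forall i j, A (M i j)) -> (forall i j, A (N i j)) ->
  forall i j, A ((M *m N) i j).
Proof.
by move=> AM AN i j; rewrite mxE; apply: subring_sum => l _; apply: subringM.
Qed.

(* If the nonzero minors of the relation module K generate the unit ideal of A
   in each size where they exist, then the minors of maximal size r do while
   those of size r + 1 vanish: this makes K a direct summand of A^n. *)
Lemma relation_projector n (K : 'rV[B]_n -> Prop) :
  K 0 -> (forall a u v, A a -> K u -> K v -> K (a *: u + v)) ->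
  (forall u, K u -> forall i, A (u 0 i)) ->
  (forall r (X : 'M[B]_(r, n)) (f : 'I_r -> 'I_n),
     (forall i, K (row i X)) -> \det (colsub f X) != 0 ->
     exists s : seq (B * 'M[B]_(r, n) * {ffun 'I_r -> 'I_n}),
       (forall p, p \in s -> A p.1.1 /\ forall i, K (row i p.1.2)) /\
       \sum_(p <- s) p.1.1 * \det (colsub p.2 p.1.2) = 1) ->
  exists E : 'M[B]_n, (forall i, K (row i E)) /\ forall x, K x -> x *m E = x.
Proof.
move=> K0 KL KA Kunit.
(* Size 0 always qualifies, the empty determinant being 1; a size above n forces a repeated column.
   So a maximal size exists. *)
pose Q r := `[< exists (X : 'M[B]_(r, n)) (f : 'I_r -> 'I_n),
  (forall i, K (row i X)) /\ \det (colsub f X) != 0 >].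
have Q0 : exists r, Q r.
  exists 0%N; apply/asboolP; exists 0, (fun i => widen_ord (leq0n n) i).
  by split=> [[]//|]; rewrite det_mx00 oner_neq0.
have Qn r : Q r -> (r <= n)%N.
  move=> /asboolP[X [f [_ /eqP det0]]]; rewrite leqNgt; apply/negP => nr.
  apply: det0; have /injectivePn[i [j ij fij]] : ~~ injectiveb f.
    by apply/negP => /injectiveP/leq_card; rewrite !card_ord leqNgt nr.
  rewrite -det_tr; apply: (determinant_alternate ij) => l.
  by rewrite !mxE fij.
have [r /asboolP[X [f [KX det_n0]]] r_max] := ex_maxnP Q0 Qn.
have [s [sP sE]] := Kunit r X f KX det_n0.
(* Cramer's rule for the matrix Y = [p.1.2] and the columns g = [p.2]: x is sent to x_g adj(Y_g) Y,
   which is det(Y_g) x for x in K. *)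
pose E1 (p : B * 'M[B]_(r, n) * {ffun 'I_r -> 'I_n}) : 'M[B]_n :=
  colsub p.2 1%:M *m \adj (colsub p.2 p.1.2) *m p.1.2.
exists (\sum_(p <- s) p.1.1 *: E1 p); split.
  have KD u v : K u -> K v -> K (u + v).
    by move=> Ku; rewrite -[u]scale1r; apply: KL => //; apply: subring1.
  have KZ a u : A a -> K u -> K (a *: u).
    by move=> Aa Ku; rewrite -[_ *: _]addr0; apply: KL.
  move=> i; rewrite linear_sum big_seq.
  apply: (big_ind K K0 KD) => p /sP[Ap Kp]; rewrite linearZ; apply: (KZ) => //=.
  rewrite /E1 row_mul mulmx_sum_row; apply: (big_ind K K0 KD) => j _.
  apply: (KZ _ _ _ (Kp j)); rewrite mxE; apply: subring_mulmx.
    by move=> a b; rewrite !mxE; case: eqP => _; [exact: subring1|exact: subring0].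
  by apply: subring_adj => a b; rewrite mxE; have := KA _ (Kp a) (p.2 b); rewrite mxE.
move=> x Kx; rewrite mulmx_sumr big_seq.
under eq_bigr => p ps.
  have -> : x *m (p.1.1 *: E1 p) = (p.1.1 * \det (colsub p.2 p.1.2)) *: x.
    have [_ Kp] := sP p ps.
    rewrite -scalemxAr -scalerA; congr (_ *: _); apply/rowP => l.
    rewrite /E1 !mulmxA mulmx_colsub mulmx1.
    set Y := p.1.2; set g := p.2.
    (* Y bordered by the row x and the column l has a minor of size r + 1, zero by maximality of r.
       Its Schur expansion is coordinate l of Cramer's formula. *)
    have : \det (block_mx (x 0 l)%:M (colsub g x) (col l Y) (colsub g Y)) = 0.
      apply/eqP/negPn/negP => n0.
      suff /r_max : Q (1 + r)%N by rewrite ltnn.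
      apply/asboolP; exists (col_mx x Y).
      exists (fun i => match split i with inl _ => l | inr i => g i end).
      split=> [i|].
        rewrite -[i]splitK; case: (split i) => i' /=.
          by rewrite rowKu ord1 row_id.
        by rewrite rowKd.
      apply: contraNneq n0 => <-; apply/eqP; congr (\det _).
      apply/matrixP => i j; rewrite [RHS]mxE -[i]splitK -[j]splitK.
      case: (split i) => i'; case: (split j) => j'.
      - by rewrite (unsplitK (inl _)) block_mxEul col_mxEu mxE !ord1.
      - by rewrite (unsplitK (inr _)) block_mxEur col_mxEu mxE !ord1.
      - by rewrite (unsplitK (inl _)) block_mxEdl col_mxEd mxE.
      - by rewrite (unsplitK (inr _)) block_mxEdr col_mxEd mxE.
    rewrite det_schur mxE eqxx => /eqP; rewrite subr_eq0 => /eqP detE.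
    rewrite [RHS]mxE [RHS]mulrC detE [LHS]mxE [RHS]mxE.
    by apply: eq_bigr => i _; rewrite (mxE _ _ i 0).
  over.
by rewrite -big_seq -scaler_suml sE scale1r.
Qed.
End SubringProp.

(** * Subalgebras and group schemes *)

Section Subalgebras.
Variable k : fieldType.

Definition subalgebra (B : comAlgType k) (A : B -> Prop) : Prop :=
  [/\ A 1, forall (c : k) x y, A x -> A y -> A (c *: x + y) &
      forall x y, A x -> A y -> A (x * y)].

Section SubalgType.
Variables (B : comAlgType k) (A : B -> Prop).
Hypothesis A_sub : subalgebra A.

Definition subalg_mem : {pred B} := [pred x | `[< A x >]].

(** The closure proof is an argument of the type, so that the algebra instances can be attached to
    it. *)
Definition subalg_type of subalgebra A : Type := {x : B | x \in subalg_mem}.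
Local Notation T := (subalg_type A_sub).

Fact subalg_mem_closed : subalg_closed subalg_mem.
Proof.
case: A_sub => A1 AL AM; split; first exact/asboolP.
  by move=> c x y /asboolP Ax /asboolP Ay; apply/asboolP/AL.
by move=> x y /asboolP Ax /asboolP Ay; apply/asboolP/AM.
Qed.

HB.instance Definition _ := SubChoice.on T.
HB.instance Definition _ := GRing.SubChoice_isSubComNzRing.Build B subalg_mem T
  subalg_mem_closed.
HB.instance Definition _ := GRing.SubZmodule_isSubLmodule.Build k B subalg_mem T
  subalg_mem_closed.
HB.instance Definition _ := GRing.SubNzRing_SubLmodule_isSubLalgebra.Build
  k B subalg_mem T.
HB.instance Definition _ := GRing.SubLalgebra_isSubAlgebra.Build
  k B subalg_mem T.

Lemma subalgebra_type : exists (T : comAlgType k) (i : points T B),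
  injective i /\ forall b, A b <-> exists t, i t = b.
Proof.
have [|||i iE] := @point_of k T B (fun x => val x).
- by move=> c x y; rewrite linearP.
- by move=> x y; rewrite rmorphM.
- by rewrite rmorph1.
exists T, i; split; first by move=> x y; rewrite !iE; apply: val_inj.
move=> b; split=> [Ab|[t <-]]; last by rewrite iE; apply/asboolP/(valP t).
have bA : b \in subalg_mem by apply/asboolP.
by exists (Sub b bA); rewrite iE.
Qed.
End SubalgType.

Lemma point_factor (B C T : comAlgType k) (i : points T B) (f : points C B) :
  injective i -> (forall c, exists t, i t = f c) ->
  exists g : points C T, acomp g i = f.
Proof.
move=> i_inj h; pose g c := projT1 (cid (h c)).
have gE c : i (g c) = f c by rewrite /g; case: cid.
have [|||u uE] := @point_of k C T g.
- by move=> a x y; apply: i_inj; rewrite gE !linearP /= !gE.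
- by move=> x y; apply: i_inj; rewrite gE !rmorphM /= !gE.
- by apply: i_inj; rewrite gE !rmorph1.
by exists u; apply: points_eq => c; rewrite acompE uE gE.
Qed.

Lemma subalgebra_subring (B : comAlgType k) (A : B -> Prop) :
  subalgebra A -> A 0 /\ (forall x y, A x -> A y -> A (x - y)).
Proof.
move=> [A1 AL _]; have A0 : A 0 by rewrite -(addNr (1 : B)) -scaleN1r; apply: AL.
by split=> // x y Ax Ay; rewrite addrC -scaleN1r; apply: AL.
Qed.
End Subalgebras.

(** An identity about arbitrary points of A and B reduces to the universal pair in T, and after the
    injection [F] that pair is restricted from points of A1 and B1. *)
Lemma tensor_embed (k : fieldType) (A B A1 B1 : comAlgType k)
    (f : points A A1) (g : points B B1) : injective f -> injective g ->
  exists (T : comAlgType k) (i : points A T) (j : points B T)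
    (T1 : comAlgType k) (i1 : points A1 T1) (j1 : points B1 T1)
    (F : points T T1),
  [/\ forall R (x : points A R) (y : points B R),
        exists u : points T R, acomp i u = x /\ acomp j u = y,
      acomp i F = acomp f i1, acomp j F = acomp g j1 & injective F].
Proof.
move=> f_inj g_inj; have [T [i [j [span pair _]]]] := tensor_algebra A B.
have [T1 [i1 [j1 [_ _ zero1]]]] := tensor_algebra A1 B1.
have [F [Fi Fj]] := pair T1 (acomp f i1) (acomp g j1).
exists T, i, j, T1, i1, j1, F; split=> //.
suff F0 z : F z = 0 -> z = 0.
  by move=> x y Fxy; apply/subr0_eq/F0; rewrite rmorphB /= Fxy subrr.
have [s ->] := span z; rewrite rmorph_sum => Fs.
suff s0 : tzero s by exact: s0.
apply: (tzero_inj f_inj g_inj) => R x y; apply: (zero1 _ _ _ (mul_bilinear x y)).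
rewrite big_map -[RHS]Fs; apply: eq_bigr => p _.
by rewrite rmorphM /= -[F (i _)]/(acomp i F _) -[F (j _)]/(acomp j F _) Fi Fj.
Qed.

(** * Group laws on points, antipode, counit and comultiplication *)

Section GroupTheory.
Variables (k : fieldType) (G : group_scheme k).
Local Notation H := (gring G).

Section Points.
Variable R : comAlgType k.
Implicit Types x y z : points H R.

Lemma gmulI x y z : gmul x y = gmul x z -> y = z.
Proof.
by move=> /(congr1 (gmul (ginv x))); rewrite !gmulA gmulV !gmul1.
Qed.

Lemma gmul1r x : gmul x (gone G R) = x.
Proof. by apply: (@gmulI (ginv x)); rewrite gmulA gmulV gmul1. Qed.

Lemma gmulVr x : gmul x (ginv x) = gone G R.
Proof. by apply: (@gmulI (ginv x)); rewrite gmulA gmulV gmul1 gmul1r. Qed.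

Lemma gidem x : gmul x x = x -> x = gone G R.
Proof. by move=> xx; apply: (@gmulI x); rewrite gmul1r. Qed.

Lemma ginv_eq x y : gmul y x = gone G R -> y = ginv x.
Proof.
by move=> yx; rewrite -[y]gmul1r -(gmulVr x) gmulA yx gmul1.
Qed.
End Points.

Lemma gone_nat R S (phi : points R S) : acomp (gone G R) phi = gone G S.
Proof. by apply: gidem; rewrite -gmul_nat gmul1. Qed.

Lemma ginv_nat R S (phi : points R S) (x : points H R) :
  acomp (ginv x) phi = ginv (acomp x phi).
Proof. by apply: ginv_eq; rewrite -gmul_nat gmulV gone_nat. Qed.

Definition antipode : points H H := ginv (idfun : points H H).

Lemma ginvE R (x : points H R) : ginv x = acomp antipode x.
Proof. by rewrite /antipode ginv_nat comp1a. Qed.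

(** The unit point over k is carried to every R by the structure map, since the unit is natural. *)
Lemma counit : exists eps : {scalar H},
  forall R h, gone G R h = (eps h)%:A.
Proof.
have epsL : scalar (gone G k^o) by move=> c x y; rewrite linearP.
pose eL := GRing.isLinear.Build k H k *%R (gone G k^o) epsL.
pose eps : {scalar H} := HB.pack (gone G k^o : H -> k) eL.
exists eps => R h.
have [|||u uE] := @point_of k k^o R (fun c => c%:A).
- by move=> c x y; rewrite scalerDl scalerA.
- by move=> x y; rewrite -scalerAl mul1r scalerA.
- by rewrite scale1r.
by rewrite -(gone_nat u) acompE uE.
Qed.

Definition comul_expr (h : H) (s : seq (H * H)) : Prop :=
  forall R (x y : points H R), gmul x y h = \sum_(p <- s) x p.1 * y p.2.

Lemma comul_exists h : exists s, comul_expr h s.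
Proof.
have [|s sE] := @natural_expr k H H H (fun R x y => gmul x y) _ h.
  by move=> R S phi x y; rewrite gmul_nat.
by exists s.
Qed.

Definition sub_hopf (A : H -> Prop) : Prop :=
  [/\ subalgebra A,
      forall h, A h -> exists2 s, comul_expr h s &
        forall p, p \in s -> A p.1 /\ A p.2
    & forall h, A h -> A (antipode h)].
End GroupTheory.

Section GroupHom.
Variables (k : fieldType) (G' G : group_scheme k).
Variable f : points (gring G') (gring G).
Hypothesis f_hom : @group_hom k G' G f.

Lemma hom_gone R : acomp f (gone G R) = gone G' R.
Proof. by apply: gidem; rewrite -f_hom gmul1. Qed.

Lemma hom_ginv R (x : points (gring G) R) : acomp f (ginv x) = ginv (acomp f x).
Proof. by apply: ginv_eq; rewrite -f_hom gmulV hom_gone. Qed.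

Lemma image_sub_hopf : sub_hopf (fun h => exists a, f a = h).
Proof.
split.
- split; first by exists 1; rewrite rmorph1.
    by move=> c _ _ [a <-] [b <-]; exists (c *: a + b); rewrite linearP.
  by move=> _ _ [a <-] [b <-]; exists (a * b); rewrite rmorphM.
- move=> _ [a <-]; have [s sE] := comul_exists a.
  exists [seq (f p.1, f p.2) | p <- s].
    by move=> R x y; rewrite big_map -[LHS]/(acomp f _ a) f_hom sE.
  by move=> _ /mapP[p _ ->]; split; [exists p.1|exists p.2].
- move=> _ [a <-]; exists (antipode G' a).
  rewrite -[LHS]/(acomp _ f a) -ginvE -[f in LHS]acomp1 -hom_ginv //.
Qed.
End GroupHom.

(** * The group scheme of a sub-Hopf algebra *)

Section SubGroup.
Variables (k : fieldType) (G : group_scheme k) (A : gring G -> Prop).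
Hypothesis A_hopf : sub_hopf A.
Variables (T : comAlgType k) (i : points T (gring G)).
Hypotheses (i_inj : injective i) (iA : forall h, A h <-> exists t, i t = h).
Local Notation H := (gring G).

Lemma sub_comul t : exists s : seq (T * T),
  forall R (x y : points H R),
    gmul x y (i t) = \sum_(p <- s) x (i p.1) * y (i p.2).
Proof.
have /(_ (i t))[|s sE sA] : forall h, A h -> exists2 s, comul_expr h s &
    forall p, p \in s -> A p.1 /\ A p.2 by case: A_hopf.
  by apply/iA; exists t.
suff [s' s'E] : exists s' : seq (T * T), s = [seq (i p.1, i p.2) | p <- s'].
  by exists s' => R x y; rewrite sE s'E big_map.
elim: s sA {sE} => [|p s IHs] sA; first by exists [::].
have [|s' ->] := IHs; first by move=> r rs; apply: sA; rewrite inE rs orbT.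
have [/iA[a aE] /iA[b bE]] := sA p (mem_head _ _).
by exists ((a, b) :: s'); rewrite /= aE bE; case: (p).
Qed.

Definition sub_comul_seq t := projT1 (cid (sub_comul t)).

Lemma sub_comulE t R (x y : points H R) :
  gmul x y (i t) = \sum_(p <- sub_comul_seq t) x (i p.1) * y (i p.2).
Proof. by rewrite /sub_comul_seq; case: cid. Qed.

(** Points of T need not extend to H, so the comparison passes through the injection of T (x) T into
    H (x) H. It frees [sub_mul_fun] from the chosen lists. *)
Lemma sum_sub_eq (s s' : seq (T * T)) :
  (forall R (x y : points H R),
    \sum_(p <- s) x (i p.1) * y (i p.2) =
    \sum_(p <- s') x (i p.1) * y (i p.2)) ->
  forall R (x y : points T R),
    \sum_(p <- s) x p.1 * y p.2 = \sum_(p <- s') x p.1 * y p.2.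
Proof.
move=> ss' R x y; apply/eqP; rewrite -subr_eq0; apply/eqP.
have : tzero (s ++ fneg s').
  apply: (tzero_inj i_inj i_inj) => S X Y.
  rewrite big_map big_cat big_map /=.
  under [X in _ + X]eq_bigr do rewrite rmorphN rmorphN mulNr.
  by rewrite sumrN ss' subrr.
move=> /(_ R x y); rewrite big_cat big_map /=.
by under [X in _ + X]eq_bigr do rewrite rmorphN mulNr; rewrite sumrN.
Qed.

Definition sub_mul_fun R (x y : points T R) (t : T) : R :=
  \sum_(p <- sub_comul_seq t) x p.1 * y p.2.

Lemma sub_mul_point R (x y : points T R) :
  exists z : points T R, z =1 sub_mul_fun x y.
Proof.
apply: point_of.
- move=> c t t'.
  pose s := fscale c (sub_comul_seq t) ++ sub_comul_seq t'.
  have sumE S (f g : points T S) : \sum_(p <- s) f p.1 * g p.2 =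
      c *: (\sum_(p <- sub_comul_seq t) f p.1 * g p.2) +
      \sum_(p <- sub_comul_seq t') f p.1 * g p.2.
    rewrite big_cat big_map scaler_sumr; congr (_ + _).
    by apply: eq_bigr => p _; rewrite linearZ scalerAl.
  rewrite /sub_mul_fun -sumE; apply: sum_sub_eq => S X Y.
  rewrite -sub_comulE linearP /= linearP /= !sub_comulE.
  exact: (esym (sumE _ (acomp i X) (acomp i Y))).
- move=> t t'.
  pose s := lmul (sub_comul_seq t) (sub_comul_seq t').
  have sumE S (f g : points T S) : \sum_(p <- s) f p.1 * g p.2 =
      (\sum_(p <- sub_comul_seq t) f p.1 * g p.2) *
      \sum_(p <- sub_comul_seq t') f p.1 * g p.2.
    rewrite (sum_lmul (fun a b => f a * g b)) mulr_suml.
    apply: eq_bigr => p _; rewrite mulr_sumr; apply: eq_bigr => r _.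
    by rewrite !rmorphM mulrACA.
  rewrite /sub_mul_fun -sumE; apply: sum_sub_eq => S X Y.
  rewrite -sub_comulE rmorphM /= rmorphM /= !sub_comulE.
  exact: (esym (sumE _ (acomp i X) (acomp i Y))).
- rewrite /sub_mul_fun.
  have -> : 1 = \sum_(p <- [:: (1, 1)] : seq (T * T)) x p.1 * y p.2.
    by rewrite big_seq1 !rmorph1 mulr1.
  apply: sum_sub_eq => S X Y.
  by rewrite -sub_comulE !rmorph1 big_seq1 !rmorph1 mulr1.
Qed.

Definition sub_mul R (x y : points T R) := projT1 (cid (sub_mul_point x y)).

Lemma sub_mulE R (x y : points T R) t :
  sub_mul x y t = \sum_(p <- sub_comul_seq t) x p.1 * y p.2.
Proof. by rewrite /sub_mul; case: cid => z /= ->. Qed.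

Lemma sub_mul_nat R S (phi : points R S) (x y : points T R) :
  acomp (sub_mul x y) phi = sub_mul (acomp x phi) (acomp y phi).
Proof.
apply: points_eq => t; rewrite acompE !sub_mulE rmorph_sum.
by apply: eq_bigr => p _; rewrite rmorphM.
Qed.

Lemma sub_mul_lift R (x y : points H R) :
  sub_mul (acomp i x) (acomp i y) = acomp i (gmul x y).
Proof. by apply: points_eq => t; rewrite sub_mulE acompE sub_comulE. Qed.

(** The universal triple lives in (T (x) T) (x) T, which embeds in (H (x) H) (x) H; there the three
    points come from points of H, where associativity is known. *)
Lemma sub_mulA R : associative (@sub_mul R).
Proof.
move=> x y z.
have [T2 [i2 [j2 [U2 [i2' [j2' [F2 [pair2 Fi2 Fj2 F2_inj]]]]]]]] :=
  tensor_embed i_inj i_inj.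
have [T3 [i3 [j3 [U3 [i3' [j3' [F3 [pair3 Fi3 Fj3 F3_inj]]]]]]]] :=
  tensor_embed F2_inj i_inj.
have [u [<- <-]] := pair2 R x y; have [w [<- <-]] := pair3 R u z.
rewrite !acompA -!sub_mul_nat; congr acomp.
apply: points_eq => t; apply: F3_inj; rewrite -![F3 _]acompE.
rewrite !sub_mul_nat -!acompA !Fi3 !Fj3 !(acompA _ F2) Fi2 Fj2 -!acompA.
by rewrite !sub_mul_lift gmulA.
Qed.

Definition sub_one R : points T R := acomp i (gone G R).

Lemma sub_mul1 R : left_id (sub_one R) (@sub_mul R).
Proof.
move=> x; transitivity (acomp (sub_mul (sub_one T) idfun) x).
  by rewrite sub_mul_nat /sub_one -acompA gone_nat comp1a.
rewrite -[RHS]comp1a; congr acomp.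
apply: points_eq => t; apply: i_inj; rewrite -![i _]acompE.
rewrite sub_mul_nat -acompA gone_nat comp1a.
by rewrite -[X in sub_mul _ X]acomp1 sub_mul_lift gmul1 acomp1.
Qed.

Lemma sub_antipode : exists S : points T T, acomp S i = acomp i (antipode G).
Proof.
apply: point_factor => // t; apply/iA.
have [_ _] := A_hopf; apply.
by apply/iA; exists t.
Qed.

Lemma sub_group : exists G' : group_scheme k, exists e : points (gring G') H,
  [/\ injective e, forall h, A h <-> exists t, e t = h & @group_hom k G' G e].
Proof.
have [S SE] := sub_antipode.
have sub_mulV R : left_inverse (sub_one R) (fun x => acomp S x) (@sub_mul R).
  move=> x; transitivity (acomp (sub_mul S idfun) x).
    by rewrite sub_mul_nat comp1a.
  rewrite /sub_one -(gone_nat G x) acompA; congr acomp.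
  apply: points_eq => t; apply: i_inj; rewrite -![i _]acompE.
  rewrite sub_mul_nat comp1a -[X in sub_mul _ X]acomp1 SE sub_mul_lift.
  by rewrite gmulV -acompA gone_nat.
exists (GroupScheme sub_mulA sub_mul1 sub_mulV sub_mul_nat), i.
by split=> // R x y; exact: (esym (sub_mul_lift x y)).
Qed.
End SubGroup.

(** Again by reduction to the universal pair of points of G', which becomes restricted from G after
    the injection [E]. *)
Lemma group_hom_factor (k : fieldType) (F G' G : group_scheme k)
    (e : points (gring G') (gring G)) (f : points (gring F) (gring G')) :
  injective e -> @group_hom k G' G e -> @group_hom k F G (acomp f e) ->
  @group_hom k F G' f.
Proof.
move=> e_inj e_hom fe_hom R x y.
have [T [i [j [U [i' [j' [E [pair Ei Ej E_inj]]]]]]]] := tensor_embed e_inj e_inj.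
have [u [<- <-]] := pair R x y.
rewrite -gmul_nat !acompA -gmul_nat; congr acomp.
apply: points_eq => t; apply: E_inj; rewrite -![E _]acompE.
rewrite gmul_nat -!acompA gmul_nat Ei Ej -e_hom !acompA.
by rewrite fe_hom.
Qed.

(** The union of the images is a sub-Hopf algebra, hence a group scheme G', and the cone factors
    through it. The universal property gives [u] from k[G] to k[G']; its composite with the
    inclusion [e] respects the cone, so it is the identity and [e] is onto. *)
Lemma group_limit_generated (k : fieldType) d (I : porderType d)
    (I_directed : directed I) (S : group_inverse_system k I)
    (G : group_scheme k)
    (p : forall i : I, {lrmorphism gring (gobj S i) -> gring G}) :
  is_group_limit p -> forall h, exists i a, p i a = h.
Proof.
move=> [[p_hom p_cone] p_univ].
pose A h := exists i a, p i a = h.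
have mono i j (ij : (i <= j)%O) a : exists b, p j b = p i a.
  by exists (gtrans S ij a); rewrite -(p_cone _ _ ij).
have two x y : A x -> A y -> exists l a b, p l a = x /\ p l b = y.
  move=> [i [a <-]] [j [b <-]]; have [_ /(_ i j)[l [il jl]]] := I_directed.
  have [a' <-] := mono _ _ il a; have [b' <-] := mono _ _ jl b.
  by exists l, a', b'.
have A_hopf : sub_hopf A.
  split.
  - split; first by case: I_directed => -[i] _; exists i, 1; rewrite rmorph1.
      move=> c x y Ax Ay; have [l [a [b [<- <-]]]] := two x y Ax Ay.
      by exists l, (c *: a + b); rewrite linearP.
    move=> x y Ax Ay; have [l [a [b [<- <-]]]] := two x y Ax Ay.
    by exists l, (a * b); rewrite rmorphM.
  - move=> h [i hi]; have [_ /(_ h hi)[s sE sA] _] := image_sub_hopf (p_hom i).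
    by exists s => // r /sA[? ?]; split; exists i.
  - by move=> h [i hi]; have [_ _ /(_ h hi)] := image_sub_hopf (p_hom i); exists i.
have [A_alg _ _] := A_hopf.
have [T [t [t_inj tA]]] := subalgebra_type A_alg.
have [G' [e [e_inj eA e_hom]]] := sub_group A_hopf t_inj tA.
have qP i : exists q : points (gring (gobj S i)) (gring G'), acomp q e = p i.
  by apply: point_factor => // a; apply/eA; exists i, a.
pose q i := projT1 (cid (qP i)).
have qE i : acomp (q i) e = p i by rewrite /q; case: cid.
have q_cone : is_group_cone q.
  split=> [i|i j ij a]; first by apply: group_hom_factor e_inj e_hom _; rewrite qE.
  have eqE l x : e (q l x) = p l x by rewrite -qE.
  by apply: e_inj; rewrite /= !eqE -(p_cone _ _ ij).
have [u [[u_hom uE] _]] := p_univ _ _ q_cone.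
have [v [_ v_uniq]] := p_univ _ _ (conj p_hom p_cone).
have id_v : v = idfun by apply: v_uniq; split=> [R x y|//]; rewrite !comp1a.
have ue_v : v = acomp u e.
  apply: v_uniq; split=> [R x y|i a].
    by rewrite -acompA e_hom u_hom !acompA.
  transitivity (acomp (q i) e a); last by rewrite qE.
  exact: (congr1 e (uE i a)).
move=> h; apply/eA; exists (u h).
by rewrite -[LHS]/(acomp u e h) -ue_v id_v.
Qed.

(** * Torsors and their quotients *)

(** A subspace that contains the slices of [s] on one side contains the entries of the reduced list
    on that side. *)
Lemma tensor_reduce_seq (k : fieldType) (V W : lmodType k) (s : seq (V * W)) :
  exists s' : seq (V * W),
  [/\ forall (Q : lmodType k) (q : V -> W -> Q), bilinear_map q ->
        \sum_(p <- s) q p.1 p.2 = \sum_(p <- s') q p.1 p.2,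
      forall p, p \in s' -> exists phi : {scalar V},
        p.2 = \sum_(r <- s) phi r.1 *: r.2
    & forall p, p \in s' -> exists psi : {scalar W},
        p.1 = \sum_(r <- s) psi r.2 *: r.1].
Proof.
have [n [e [w [sE [phi phiE] [psi psiE]]]]] := tensor_reduce s.
exists [seq (e i, w i) | i <- index_enum 'I_n]; split=> [Q q qb|p|p].
- by rewrite big_map sE.
- move=> /mapP[i _ ->]; exists (phi i); rewrite (sE _ _ (slicel_bilinear _ _)).
  rewrite (bigD1 i) //= phiE eqxx scale1r big1 ?addr0 // => j ji.
  by rewrite phiE eq_sym (negPf ji) scale0r.
- move=> /mapP[i _ ->]; exists (psi i); rewrite (sE _ _ (slicer_bilinear _ _)).
  rewrite (bigD1 i) //= psiE eqxx scale1r big1 ?addr0 // => j ji.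
  by rewrite psiE eq_sym (negPf ji) scale0r.
Qed.

Section SubalgSums.
Variables (k : fieldType) (B : comAlgType k) (A : B -> Prop).
Hypothesis A_alg : subalgebra A.

Lemma subalgebra_submodule : submodule A.
Proof.
have [A0 _] := subalgebra_subring A_alg; case: A_alg => _ AL _.
by split=> // a u v; apply: AL.
Qed.

Lemma subalgebraM x y : A x -> A y -> A (x * y).
Proof. by case: A_alg => _ _; apply. Qed.
End SubalgSums.

Section TorsorTheory.
Variables (k : fieldType) (G : group_scheme k) (P : torsor G).
Local Notation H := (gring G).
Local Notation B := (tring P).

(** The inverse of [theta], taken at the point (x, y) of P x P. *)
Lemma torsor_div R (x y : points B R) : exists g : points H R, tact g y = x.
Proof.
have [GP [p1 [p2 [PP [q1 [q2 [theta [prodGP prodPP thq1 thq2 [th' [thK th'K]]]]]]]]]]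
  := torsor_iso P.
have [z [[zx zy] _]] := prodPP R x y.
have thz : acomp theta (acomp th' z) = z.
  by apply: points_eq => a; rewrite !acompE thK.
exists (acomp p1 (acomp th' z)).
have -> : y = acomp p2 (acomp th' z) by rewrite -thq2 -acompA thz zy.
by rewrite -tact_nat -thq1 -acompA thz.
Qed.

Lemma torsor_free R (g g' : points H R) (y : points B R) :
  tact g y = tact g' y -> g = g'.
Proof.
have [GP [p1 [p2 [PP [q1 [q2 [theta [prodGP prodPP thq1 thq2 [th' [thK th'K]]]]]]]]]]
  := torsor_iso P.
have [w [[<- wy] _]] := prodGP R g y; have [w' [[<- w'y] _]] := prodGP R g' y.
move=> gg'; suff -> : w = w' by [].
have [z [_ z_uniq]] := prodPP R (acomp q1 (acomp theta w)) y.
have e1 : z = acomp theta w.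
  by apply: z_uniq; split=> //; rewrite acompA thq2 wy.
have e2 : z = acomp theta w'.
  apply: z_uniq; split; last by rewrite acompA thq2 w'y.
  by rewrite !acompA thq1 !tact_nat wy w'y.
apply: points_eq => a; rewrite -[a]th'K -!(acompE theta).
by rewrite -e1 e2.
Qed.

Definition tdiv R (x y : points B R) : points H R :=
  projT1 (cid (torsor_div x y)).

Lemma tdivP R (x y : points B R) : tact (tdiv x y) y = x.
Proof. by rewrite /tdiv; case: cid. Qed.

Lemma tdiv_nat R S (phi : points R S) (x y : points B R) :
  acomp (tdiv x y) phi = tdiv (acomp x phi) (acomp y phi).
Proof. by apply: (@torsor_free _ _ _ (acomp y phi)); rewrite -tact_nat !tdivP. Qed.

Lemma tdivV R (x y : points B R) : tdiv x y = ginv (tdiv y x).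
Proof.
apply: (@torsor_free _ _ _ y); rewrite tdivP.
have := tdivP y x; move: (tdiv y x) => g <-.
by rewrite -tactM gmulV tact1.
Qed.

Lemma tdiv_act R (g : points H R) (x y : points B R) :
  tdiv (tact g x) y = gmul g (tdiv x y).
Proof. by apply: (@torsor_free _ _ _ y); rewrite tactM !tdivP. Qed.

Definition coact_expr (b : B) (s : seq (H * B)) : Prop :=
  forall R (g : points H R) (x : points B R),
    tact g x b = \sum_(p <- s) g p.1 * x p.2.

Lemma coact_exists b : exists s, coact_expr b s.
Proof.
have [|s sE] := @natural_expr k H B B (fun R g x => tact g x) _ b.
  by move=> R S phi g x; rewrite tact_nat.
by exists s.
Qed.

Definition tdiv_expr (h : H) (s : seq (B * B)) : Prop :=
  forall R (x y : points B R), tdiv x y h = \sum_(p <- s) x p.1 * y p.2.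

Lemma tdiv_exists h : exists s, tdiv_expr h s.
Proof.
have [|s sE] := @natural_expr k B B H (fun R x y => tdiv x y) _ h.
  by move=> R S phi x y; rewrite tdiv_nat.
by exists s.
Qed.

Lemma coact_slice_eq (b : B) s s' (phi : {scalar H}) :
  coact_expr b s -> coact_expr b s' ->
  \sum_(p <- s) phi p.1 *: p.2 = \sum_(p <- s') phi p.1 *: p.2.
Proof.
move=> sE s'E; apply/eqP; rewrite -subr_eq0; apply/eqP.
have : tzero (s ++ fneg s').
  move=> R g x; rewrite big_cat big_map /=.
  under [X in _ + X]eq_bigr do rewrite rmorphN mulNr.
  by rewrite sumrN -sE -s'E subrr.
move/(tzero_slicel phi); rewrite big_cat big_map /=.
by under [X in _ + X]eq_bigr do rewrite linearN scaleNr; rewrite sumrN.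
Qed.

Section Quotient.
Variable K : H -> Prop.
Hypothesis K_hopf : sub_hopf K.

(* The ring of functions on the quotient of P by the kernel of G -> Spec K. *)
Definition invar (b : B) : Prop :=
  exists2 s, coact_expr b s & forall p, p \in s -> K p.1.

Lemma invar_subalgebra : subalgebra invar.
Proof.
have [[K1 KL KM] _ _] := K_hopf.
have [K0 _] := subalgebra_subring (And3 K1 KL KM).
have KZ c h : K h -> K (c *: h) by move=> Kh; rewrite -[_ *: _]addr0; apply: KL.
split.
- exists [:: (1, 1)] => [R g x|p]; first by rewrite big_seq1 !rmorph1 mulr1.
  by rewrite inE => /eqP ->.
- move=> c b b' [s sE sK] [s' s'E s'K]; exists (fscale c s ++ s') => [R g x|p].
    rewrite linearP /= sE s'E big_cat big_map scaler_sumr; congr (_ + _).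
    by apply: eq_bigr => p _; rewrite linearZ scalerAl.
  by rewrite mem_cat => /orP[/mapP[r /sK Kr ->]|/s'K//]; apply: KZ.
- move=> b b' [s sE sK] [s' s'E s'K]; exists (lmul s s') => [R g x|p].
    rewrite rmorphM /= sE s'E (sum_lmul (fun a b => g a * x b)) mulr_suml.
    apply: eq_bigr => p _; rewrite mulr_sumr; apply: eq_bigr => r _.
    by rewrite !rmorphM mulrACA.
  by move=> /allpairsP[[r r'] [/= /sK ? /s'K ? ->]]; apply: KM.
Qed.

(** The choice is total, with membership in [K] kept as a conditional clause, so that [c] can be
    mapped over lists. *)
Lemma comul_choice : exists c : H -> seq (H * H),
  forall h, comul_expr h (c h) /\
    (K h -> forall p, p \in c h -> K p.1 /\ K p.2).
Proof.
have ex h : exists s, comul_expr h s /\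
    (K h -> forall p, p \in s -> K p.1 /\ K p.2).
  have [Kh|nKh] := pselect (K h).
    by have [_ /(_ h Kh)[s sE sK] _] := K_hopf; exists s.
  by have [s sE] := comul_exists h; exists s.
by have [c cP] := choice ex; exists c.
Qed.

(** Coassociativity: b at g (g' x) is computed in two ways, with (g', x) universal. Slicing the
    variable g by [phi] expresses the coaction of the slice through the right entries of
    comultiplications of elements of [K], which lie in [K]. *)
Lemma invar_slice b s (phi : {scalar H}) : invar b -> coact_expr b s ->
  invar (\sum_(p <- s) phi p.1 *: p.2).
Proof.
move=> [s0 s0E s0K] sE.
rewrite (coact_slice_eq phi sE s0E).
have [c cP] := comul_choice.
have [C [i [j [_ pair _]]]] := tensor_algebra H B.
pose L := flatten [seq [seq (r.1, i r.2 * j p.2) | r <- c p.1] | p <- s0].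
have L0 : tzero ([seq (p.1, tact i j p.2) | p <- s0] ++ fneg L).
  move=> R g z; rewrite big_cat !big_map big_flatten big_map /=.
  under [X in _ + X]eq_bigr => p _ do rewrite big_map.
  apply/eqP; rewrite addr_eq0 -sumrN; apply/eqP.
  transitivity (tact g (acomp (tact i j) z) b).
    by rewrite s0E; apply: eq_bigr.
  rewrite tact_nat -tactM s0E; apply: eq_bigr => p _.
  have [-> _] := cP p.1; rewrite mulr_suml -sumrN; apply: eq_bigr => r _.
  by rewrite rmorphN mulNr opprK /= rmorphM mulrA.
have := tzero_slicel phi L0.
rewrite big_cat !big_map big_flatten big_map /= => /eqP.
rewrite addr_eq0 => /eqP slE.
exists (flatten [seq [seq (r.2, phi r.1 *: p.2) | r <- c p.1] | p <- s0]).
  move=> R g x; have [u [<- <-]] := pair R g x.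
  rewrite -tact_nat acompE linear_sum /=.
  under eq_bigr do rewrite linearZ /=.
  rewrite slE rmorphN rmorph_sum -sumrN big_flatten big_map.
  apply: eq_bigr => p _; rewrite !big_map rmorph_sum -sumrN.
  apply: eq_bigr => r _; rewrite linearN scaleNr rmorphN opprK /=.
  by rewrite linearZ /= rmorphM /= !linearZ /= -scalerAr.
move=> _ /flatten_mapP[p ps0 /mapP[r rc ->]] /=.
have [_ /(_ (s0K p ps0))] := cP p.1.
by case/(_ r rc).
Qed.

Lemma invar_coact b : invar b ->
  exists2 s, coact_expr b s & forall p, p \in s -> K p.1 /\ invar p.2.
Proof.
move=> b_inv; have [s sE sK] := b_inv.
have [s' [s'E s'2 s'1]] := tensor_reduce_seq s.
exists s' => [R g x|p ps'].
  by rewrite sE (s'E _ _ (mul_bilinear g x)).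
split; last by have [phi ->] := s'2 p ps'; exact: invar_slice phi b_inv sE.
have [psi ->] := s'1 p ps'; have [K_alg _ _] := K_hopf.
apply: (submodule_sum_seq (subalgebra_submodule K_alg)) => r rs.
by apply: (submoduleZ (subalgebra_submodule K_alg)); apply: sK.
Qed.

(** After reduction the left entries are slices in the variable y. By equivariance of x / y in x,
    their coaction involves only the left entries of the comultiplication of h, which lie in [K]. *)
Lemma tdiv_invar_l h : K h ->
  exists2 s, tdiv_expr h s & forall p, p \in s -> invar p.1.
Proof.
move=> Kh; have [s sE] := tdiv_exists h.
have [s' [s'E _ s'1]] := tensor_reduce_seq s.
exists s' => [R x y|p ps'].
  by rewrite sE (s'E _ _ (mul_bilinear x y)).
have [psi ->] := s'1 p ps'.
have [c cP] := comul_choice; have [ch chK] := cP h.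
have [d dE] := choice tdiv_exists.
have [C [i [j [_ pair _]]]] := tensor_algebra H B.
pose L := flatten [seq [seq (i r.1 * j v.1, v.2) | v <- d r.2] | r <- c h].
have L0 : tzero ([seq (tact i j r.1, r.2) | r <- s] ++ fneg L).
  move=> R z y; rewrite big_cat !big_map big_flatten big_map /=.
  apply/eqP; rewrite addr_eq0 -sumrN; apply/eqP.
  transitivity (tdiv (acomp (tact i j) z) y h); first by rewrite sE.
  rewrite tact_nat tdiv_act ch; apply: eq_bigr => r _.
  rewrite dE mulr_sumr big_map -sumrN; apply: eq_bigr => v _.
  by rewrite rmorphN mulNr opprK /= rmorphM mulrA.
have := tzero_slicer psi L0.
rewrite big_cat !big_map big_flatten big_map /= => /eqP.
rewrite addr_eq0 => /eqP slE.
exists (flatten [seq [seq (r.1, psi v.2 *: v.1) | v <- d r.2] | r <- c h]).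
  move=> R g x; have [u [<- <-]] := pair R g x.
  rewrite -tact_nat acompE linear_sum /=.
  under eq_bigr do rewrite linearZ /=.
  rewrite slE rmorphN rmorph_sum -sumrN big_flatten big_map.
  apply: eq_bigr => r _; rewrite !big_map rmorph_sum -sumrN.
  apply: eq_bigr => v _; rewrite scalerN rmorphN opprK /=.
  by rewrite linearZ /= rmorphM /= !linearZ /= -scalerAr.
by move=> _ /flatten_mapP[r rc /mapP[v _ ->]] /=; case: (chK Kh r rc).
Qed.

(** x / y is the inverse of y / x, and the antipode preserves [K]. *)
Lemma tdiv_invar_r h : K h ->
  exists2 s, tdiv_expr h s & forall p, p \in s -> invar p.2.
Proof.
move=> Kh; have [_ _ /(_ h Kh) Kah] := K_hopf.
have [s sE s_inv] := tdiv_invar_l Kah.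
exists [seq (p.2, p.1) | p <- s] => [R x y|_ /mapP[r /s_inv ? ->]//].
rewrite tdivV ginvE acompE sE big_map.
by apply: eq_bigr => p _; rewrite mulrC.
Qed.
End Quotient.
End TorsorTheory.

(** * Flatness of the quotients *)

Lemma ord_slicer (k : fieldType) (A B : comAlgType k) n (a : 'I_n -> A)
    (b : 'I_n -> B) (psi : {scalar B}) :
  (forall R (x : points A R) (y : points B R), \sum_i x (a i) * y (b i) = 0) ->
  \sum_i psi (b i) *: a i = 0.
Proof.
move=> ab0; have s0 : tzero [seq (a i, b i) | i <- index_enum 'I_n].
  by move=> R x y; rewrite big_map ab0.
by have := tzero_slicer psi s0; rewrite big_map.
Qed.

(** * Finite stable subspaces of the coordinate ring of P *)

Section Comodules.
Variables (k : fieldType) (G : group_scheme k) (P : torsor G).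
Local Notation H := (gring G).
Local Notation B := (tring P).

(* The column h spans a G-stable subspace of B, on which G acts through the
   matrix t. *)
Definition comodule n (h : 'cV[B]_n) (t : 'M[H]_n) : Prop :=
  (forall R (g : points H R) (x : points B R),
     map_mx (tact g x) h = map_mx g t *m map_mx x h) /\
  (forall R (g : points H R), map_mx g t *m map_mx (ginv g) t = 1%:M).

(** In a reduced expression of the coaction of b by e_i (x) w_i, the w_i are slices of the coaction
    and span a stable space containing b. Being slices, they are invariant under whatever fixes b,
    for every [K] at once. *)
Lemma comodule1 (b : B) : exists n (h : 'cV[B]_n) (t : 'M[H]_n),
  [/\ comodule h t,
      exists c : 'I_n -> k, b = \sum_i c i *: h i 0
    & forall K : H -> Prop, sub_hopf K -> invar K b ->
        forall i, invar K (h i 0)].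
Proof.
have [s sE] := coact_exists b.
have [n [e [w [s'E [phi phiE] [psi psiE]]]]] := tensor_reduce s.
have bE R (g : points H R) (x : points B R) :
    tact g x b = \sum_i g (e i) * x (w i).
  by rewrite sE (s'E _ _ (mul_bilinear g x)).
have [eps epsE] := counit G.
have [c cP] := choice (@comul_exists k G).
(* Coassociativity sliced by [phi i] gives the action on [w i] with these coefficients. *)
pose t : 'M[H]_n := \matrix_(i, m) \sum_(r <- c (e m)) phi i r.1 *: r.2.
have wE R (g : points H R) (x : points B R) i :
    tact g x (w i) = \sum_m g (t i m) * x (w m).
  have [C [u [v [_ pair _]]]] := tensor_algebra H B.
  have [z [<- <-]] := pair R g x; rewrite -tact_nat acompE.
  suff -> : tact u v (w i) = \sum_m u (t i m) * v (w m).
    by rewrite rmorph_sum; apply: eq_bigr => m _; rewrite rmorphM.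
  pose L := [seq (e m, tact u v (w m)) | m <- index_enum 'I_n] ++
    fneg (flatten [seq [seq (r.1, u r.2 * v (w m)) | r <- c (e m)]
                  | m <- index_enum 'I_n]).
  have L0 : tzero L.
    move=> S g' z'; rewrite big_cat !big_map big_flatten big_map /=.
    apply/eqP; rewrite addr_eq0 -sumrN; apply/eqP.
    transitivity (tact g' (acomp (tact u v) z') b).
      by rewrite bE; apply: eq_bigr.
    rewrite tact_nat -tactM bE; apply: eq_bigr => m _.
    rewrite cP mulr_suml big_map -sumrN; apply: eq_bigr => r _.
    by rewrite rmorphN mulNr opprK /= rmorphM mulrA.
  have := tzero_slicel (phi i) L0.
  rewrite big_cat !big_map big_flatten big_map /= => /eqP.
  rewrite addr_eq0 => /eqP.
  rewrite (bigD1 i) //= phiE eqxx scale1r big1 ?addr0; last first.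
    by move=> j ji; rewrite phiE eq_sym (negPf ji) scale0r.
  move=> ->; rewrite -sumrN; apply: eq_bigr => m _.
  rewrite mxE rmorph_sum big_map mulr_suml -sumrN; apply: eq_bigr => r _.
  by rewrite linearN scaleNr opprK /= linearZ scalerAl.
have tM R (g g' : points H R) i m :
    gmul g g' (t i m) = \sum_l g (t i l) * g' (t l m).
  have [C [u [v [_ pair _]]]] := tensor_algebra H H.
  have [z [<- <-]] := pair R g g'; rewrite -gmul_nat acompE.
  suff -> : gmul u v (t i m) = \sum_l u (t i l) * v (t l m).
    by rewrite rmorph_sum; apply: eq_bigr => l _; rewrite rmorphM.
  (* The defects satisfy a_m (x) w_m summing to 0, because both sides act alike on the w_m; slicing
     by [psi m] kills each defect. *)
  pose a m := gmul u v (t i m) - \sum_l u (t i l) * v (t l m).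
  have aw0 S (z' : points C S) (x : points B S) :
      \sum_m z' (a m) * x (w m) = 0.
    under eq_bigr do rewrite rmorphB mulrBl /=.
    apply/eqP; rewrite sumrB subr_eq0; apply/eqP.
    under [RHS]eq_bigr do rewrite rmorph_sum mulr_suml /=.
    rewrite exchange_big /=.
    transitivity (tact (gmul (acomp u z') (acomp v z')) x (w i)).
      by rewrite -gmul_nat wE; apply: eq_bigr.
    rewrite tactM wE; apply: eq_bigr => l _; rewrite wE mulr_sumr.
    by apply: eq_bigr => j _; rewrite rmorphM mulrA.
  have := ord_slicer (psi m) aw0; rewrite (bigD1 m) //= psiE eqxx scale1r.
  rewrite big1 ?addr0 => [/subr0_eq//|j jm].
  by rewrite psiE eq_sym (negPf jm) scale0r.
have t1 R i m : gone G R (t i m) = (i == m)%:R.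
  rewrite epsE; suff -> : eps (t i m) = (i == m)%:R by rewrite scaler_nat.
  have := wE B (gone G B) idfun i; rewrite tact1 /= => /(congr1 (psi m)).
  rewrite psiE linear_sum /= (bigD1 m) //= epsE -scalerAl mul1r linearZ /= psiE.
  rewrite eqxx mulr1 big1 ?addr0 => [<-|j jm]; first by rewrite eq_sym.
  by rewrite epsE -scalerAl mul1r linearZ /= psiE eq_sym (negPf jm) mulr0.
exists n, (\col_i w i), t; split.
- split=> [R g x|R g].
    apply/colP => i; rewrite !mxE wE; apply: eq_bigr => m _.
    by rewrite !mxE.
  apply/matrixP => i m; rewrite !mxE -(t1 R) -(gmulVr g) tM.
  by apply: eq_bigr => l _; rewrite !mxE.
- exists (fun i => eps (e i)); rewrite -[LHS]/((idfun : points B B) b).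
  rewrite -(tact1 idfun) bE; apply: eq_bigr => i _.
  by rewrite mxE epsE -scalerAl mul1r.
- move=> K K_hopf bK i; rewrite mxE.
  have -> : w i = \sum_(p <- s) phi i p.1 *: p.2.
    rewrite (s'E _ _ (slicel_bilinear _ _)) (bigD1 i) //= phiE eqxx scale1r.
    by rewrite big1 ?addr0 // => j ji; rewrite phiE eq_sym (negPf ji) scale0r.
  exact: invar_slice sE.
Qed.

(** A direct sum of comodules. The stacked column may have dependent entries, so the invertibility
    of [t] is carried in [comodule] rather than deduced. *)
Lemma comodule_family m (b : 'I_m -> B) : exists n (h : 'cV[B]_n) (t : 'M[H]_n),
  [/\ comodule h t,
      exists c : 'I_m -> 'I_n -> k, forall j, b j = \sum_i c j i *: h i 0
    & forall K : H -> Prop, sub_hopf K -> (forall j, invar K (b j)) ->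
        forall i, invar K (h i 0)].
Proof.
elim: m b => [|m IHm] b.
  exists 0%N, 0, 0; split; last by move=> ? _ _ [].
    by split=> *; apply/matrixP => -[].
  by exists (fun _ _ => 0) => -[].
have [n1 [h1 [t1 [[h1E t1V] [c1 b1E] inv1]]]] := comodule1 (b ord0).
have [n2 [h2 [t2 [[h2E t2V] [c2 b2E] inv2]]]] := IHm (fun j => b (lift ord0 j)).
exists (n1 + n2)%N, (col_mx h1 h2), (block_mx t1 0 0 t2); split.
- split=> [R g x|R g].
    rewrite map_block_mx !map_col_mx !map_mx0 mul_block_col !mul0mx addr0 add0r.
    by rewrite h1E h2E.
  rewrite !map_block_mx !map_mx0 mulmx_block !mulmx0 !mul0mx !addr0 !add0r.
  by rewrite t1V t2V -scalar_mx_block.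
- exists (fun j i => match unlift ord0 j, split i with
    | None, inl i1 => c1 i1 | Some j', inr i2 => c2 j' i2 | _, _ => 0 end).
  move=> j; rewrite big_split_ord /=.
  case: (unliftP ord0 j) => [j' ->|->].
    rewrite big1 ?add0r => [|i _]; last by rewrite (unsplitK (inl i)) scale0r.
    rewrite b2E; apply: eq_bigr => i _.
    by rewrite (unsplitK (inr i)) col_mxEd.
  rewrite addrC big1 ?add0r => [|i _]; last by rewrite (unsplitK (inr i)) scale0r.
  rewrite b1E; apply: eq_bigr => i _.
  by rewrite (unsplitK (inl i)) col_mxEu.
- move=> K K_hopf bK i; rewrite -[i]splitK; case: (split i) => i' /=.
    by rewrite col_mxEu; apply: inv1.
  by rewrite col_mxEd; apply: inv2.
Qed.
End Comodules.

(** * Relations over the ring of a quotient and the stability of their minors *)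

Section Relations.
Variables (k : fieldType) (G : group_scheme k) (P : torsor G).
Local Notation H := (gring G).
Local Notation B := (tring P).

Variable K : H -> Prop.
Hypothesis K_hopf : sub_hopf K.
Local Notation A := (@invar k G P K).

Let A_alg : subalgebra A := invar_subalgebra P K_hopf.
Let A_sub : submodule A := subalgebra_submodule A_alg.
Let AM x y : A x -> A y -> A (x * y) := @subalgebraM _ _ _ A_alg x y.

Lemma invar_subring : subring_prop A.
Proof.
have [_ AB] := subalgebra_subring A_alg.
by split=> //; case: A_alg.
Qed.

(* Transitivity of G on P enters here: at the universal points x, y of P,
   evaluating b at x = tdiv x y . y shows that b (x) 1 lies in B (x) J. *)
Lemma stable_ideal_unit (J : B -> Prop) b s :
  submodule J -> (forall a x, A a -> J x -> J (a * x)) ->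
  b <> 0 -> A b -> coact_expr b s -> (forall p, p \in s -> J p.2) -> J 1.
Proof.
move=> Jsub JA b0 [s0 s0E s0K] sE sJ.
(* Of the two expressions of the coaction, [s0] has left entries in [K] and [s] has right entries in
   [J]; the reduced list has both properties, its entries being slices. *)
have [s1 [s1E s12 s11]] := tensor_reduce_seq s0.
have [K_alg _ _] := K_hopf; have Ksub := subalgebra_submodule K_alg.
have s1K p : p \in s1 -> K p.1.
  move=> /s11[psi ->]; apply: (submodule_sum_seq Ksub) => r /s0K Kr.
  exact: submoduleZ.
have s1J p : p \in s1 -> J p.2.
  move=> /s12[phi ->]; rewrite (coact_slice_eq phi s0E sE).
  by apply: (submodule_sum_seq Jsub) => r /sJ Jr; apply: submoduleZ.
have ex h : exists d : seq (B * B), K h -> tdiv_expr h d /\ forall v, v \in d -> A v.2.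
  have [Kh|nKh] := pselect (K h); last by exists [::] => /nKh.
  by have [d dE dA] := @tdiv_invar_r _ _ P _ K_hopf h Kh; exists d.
have [d dP] := choice ex.
pose L := [:: (b, 1)] ++
  fneg (flatten [seq [seq (v.1, v.2 * p.2) | v <- d p.1] | p <- s1]).
have L0 : tzero L.
  move=> R x y; rewrite big_cat big_seq1 big_map big_flatten big_map /=.
  apply/eqP; rewrite rmorph1 mulr1 addr_eq0 -sumrN; apply/eqP.
  transitivity (tact (tdiv x y) y b); first by rewrite tdivP.
  rewrite s0E (s1E _ _ (mul_bilinear _ _)).
  rewrite big_seq [RHS]big_seq; apply: eq_bigr => p ps1.
  have [-> _] := dP p.1 (s1K p ps1).
  rewrite big_map mulr_suml -sumrN; apply: eq_bigr => v _.
  by rewrite rmorphN mulNr opprK /= rmorphM mulrA.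
(* Slicing by a functional equal to 1 at b turns b (x) 1 into 1 and the other side into an element
   of [J]. *)
have [phi phi1] := functional_neq0 b0.
have := tzero_slicel phi L0.
rewrite big_cat big_seq1 big_map /= phi1 scale1r => /eqP.
rewrite addr_eq0 => /eqP ->; apply: submoduleN => //.
apply: submodule_sum_seq => // _ /flatten_mapP[p ps1 /mapP[v vd ->]] /=.
apply: submoduleZ => //; apply: JA; last exact: s1J.
by have [_] := dP p.1 (s1K p ps1); apply.
Qed.

Variables (n : nat) (h : 'cV[B]_n) (t : 'M[H]_n).
Hypothesis ht : comodule h t.
Variable C : B -> Prop.
Hypotheses (C_sub : submodule C)
  (C_A : forall a x, A a -> C x -> C (a * x))
  (C_slice : forall b s (phi : {scalar H}), C b -> coact_expr b s ->
     C (\sum_(p <- s) phi p.1 *: p.2)).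

(** [C] is 0 when flatness is proved and the ring of the quotient itself when ideals are shown to be
    contracted. *)
Definition relation (a : 'rV[B]_n) : Prop :=
  (forall i, A (a 0 i)) /\ C ((a *m h) 0 0).

Lemma relation0 : relation 0.
Proof.
split=> [i|]; first by rewrite mxE; apply: submodule0.
by rewrite mul0mx mxE; apply: submodule0.
Qed.

Lemma relationL a u v : A a -> relation u -> relation v -> relation (a *: u + v).
Proof.
move=> Aa [uA uC] [vA vC]; split=> [i|].
  by rewrite !mxE; apply: submoduleD => //; apply: AM.
rewrite mulmxDl -scalemxAl mxE [X in X + _]mxE.
by apply: submoduleD => //; apply: C_A.
Qed.

(** The combination a h evaluated at g y is a(g y) t(g) h(y). The coefficients of the row a(g y)
    t(g) along H are thus relations again, [C] being closed under slices. *)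
Lemma relation_stable a : relation a ->
  exists s : seq (H * 'rV[B]_n), (forall p, p \in s -> relation p.2) /\
    forall R (g : points H R) (y : points B R),
      map_mx (tact g y) a *m map_mx g t =
      \sum_(p <- s) g p.1 *: map_mx y p.2.
Proof.
move=> [aA aC].
have [sa saP] := choice (fun i => let: ex_intro2 s sE sK :=
  invar_coact K_hopf (aA i) in ex_intro
    (fun s => coact_expr (a 0 i) s /\ forall p, p \in s -> K p.1 /\ A p.2)
    s (conj sE sK)).
(* Finite functions into B inherit its k-module structure, in which the list of rows can be reduced
   and sliced. *)
pose W := {ffun 'I_n -> B}.
pose s0 : seq (H * W) := [seq (p.1 * t il.1 il.2,
  [ffun l => if l == il.2 then p.2 else 0]) |
  il <- index_enum ('I_n * 'I_n)%type, p <- sa il.1].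
have s0E R (g : points H R) (y : points B R) l :
    (map_mx (tact g y) a *m map_mx g t) 0 l = \sum_(r <- s0) g r.1 * y (r.2 l).
  rewrite big_allpairs_dep /= -(pair_bigA _ (fun i l' => \sum_(p <- sa i)
    g (p.1 * t i l') * y ([ffun l => if l == l' then p.2 else 0] l))) /=.
  rewrite mxE; apply: eq_bigr => i _; rewrite !mxE (bigD1 l) //=.
  rewrite [X in _ + X]big1 ?addr0 => [|l' l'l]; last first.
    by apply: big1 => p _; rewrite ffunE eq_sym (negPf l'l) rmorph0 mulr0.
  have [-> _] := saP i; rewrite mulr_suml; apply: eq_bigr => p _.
  by rewrite ffunE eqxx rmorphM mulrAC.
have [s1 [s1E s12 _]] := tensor_reduce_seq s0.
exists [seq (r.1, \row_l (r.2 : W) l) | r <- s1]; split; last first.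
  move=> R g y; apply/rowP => l; rewrite s0E big_map summxE.
  have qb : bilinear_map (fun (x : H) (f : W) => g x * y (f l)).
    split=> [c b f f'|f b c c']; last by rewrite linearP mulrDl scalerAl.
    by rewrite !ffunE linearP mulrDr scalerAr.
  by rewrite (s1E _ _ qb); apply: eq_bigr => r _; rewrite !mxE.
move=> _ /mapP[r rs1 ->] /=; have [phi rE] := s12 r rs1.
have rlE l : r.2 l = \sum_(p <- s0) phi p.1 *: p.2 l.
  by rewrite rE sum_ffunE; apply: eq_bigr => p _; rewrite ffunE.
split=> [l|].
  rewrite mxE rlE; apply: submodule_sum_seq => // p /allpairsPdep[il [v [_ vs ->]]].
  apply: submoduleZ => //; rewrite ffunE; case: eqP => _; last exact: submodule0.
  by have [_ /(_ v vs)[]] := saP il.1.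
have cE : coact_expr ((a *m h) 0 0)
    [seq (p.1, \sum_l (p.2 : W) l * h l 0) | p <- s0].
  move=> R g y; rewrite big_map /=.
  have -> : tact g y ((a *m h) 0 0) = (map_mx (tact g y) (a *m h)) 0 0.
    by rewrite [RHS]mxE.
  rewrite map_mxM ht.1 mulmxA mxE.
  transitivity (\sum_j (\sum_(r <- s0) g r.1 * y (r.2 j)) * y (h j 0)).
    by apply: eq_bigr => j _; congr (_ * _); [exact: s0E|rewrite mxE].
  under [LHS]eq_bigr do rewrite mulr_suml.
  rewrite exchange_big; apply: eq_bigr => p _; rewrite rmorph_sum mulr_sumr.
  by apply: eq_bigr => l _; rewrite rmorphM mulrA.
have := C_slice phi aC cE; rewrite big_map /=.
congr C; rewrite mxE; under [RHS]eq_bigr do rewrite mxE rlE mulr_suml.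
rewrite exchange_big; apply: eq_bigr => p _; rewrite scaler_sumr.
by apply: eq_bigr => l _; rewrite scalerAl.
Qed.

Section Minors.
Variable r : nat.

Definition minor_ideal (b : B) : Prop :=
  exists s : seq (B * 'M[B]_(r, n) * {ffun 'I_r -> 'I_n}),
    (forall p, p \in s -> A p.1.1 /\ forall i, relation (row i p.1.2)) /\
    \sum_(p <- s) p.1.1 * \det (colsub p.2 p.1.2) = b.

Lemma minor_idealM a b : A a -> minor_ideal b -> minor_ideal (a * b).
Proof.
move=> Aa [s [sA <-]]; exists [seq (a * p.1.1, p.1.2, p.2) | p <- s]; split.
  by move=> _ /mapP[p /sA[pA pr] ->] /=; split=> //; apply: AM.
by rewrite big_map mulr_sumr; apply: eq_bigr => p _; rewrite mulrA.
Qed.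

Lemma minor_ideal_submodule : submodule minor_ideal.
Proof.
split; first by exists [::]; rewrite big_nil.
move=> c u v Ju [s' [s'A <-]]; rewrite -[u]mul1r scalerAl.
have [|s [sA <-]] := minor_idealM (a := c%:A) _ Ju.
  by apply: submoduleZ => //; case: A_alg.
exists (s ++ s'); split; last by rewrite big_cat.
by move=> p; rewrite mem_cat => /orP[/sA|/s'A].
Qed.

(** X(g y) is (X(g y) t(g)) t(g)^-1. The rows of the first factor are H-combinations of relations at
    y, and the second factor has entries in H; expanding rows and then columns leaves minors of
    relations at y with coefficients in H. *)
Lemma minor_coact (X : 'M[B]_(r, n)) (f : 'I_r -> 'I_n) :
  (forall i, relation (row i X)) ->
  exists2 s, coact_expr (\det (colsub f X)) s &
    forall p, p \in s -> minor_ideal p.2.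
Proof.
move=> Xrel; have [T [u [v [_ pair _]]]] := tensor_algebra H B.
have Jsub := minor_ideal_submodule.
pose L (z : T) := exists s : seq (H * B),
  (forall p, p \in s -> minor_ideal p.2) /\ z = \sum_(p <- s) u p.1 * v p.2.
have L0 : L 0 by exists [::]; rewrite big_nil.
have LD z z' : L z -> L z' -> L (z + z').
  move=> [s [sJ ->]] [s' [s'J ->]]; exists (s ++ s'); rewrite big_cat.
  by split=> // p; rewrite mem_cat => /orP[/sJ|/s'J].
pose U z := exists a, z = u a.
have LU c z : U c -> L z -> L (c * z).
  move=> [a ->] [s [sJ ->]]; exists [seq (a * p.1, p.2) | p <- s]; split.
    by move=> _ /mapP[p /sJ pJ ->].
  by rewrite big_map mulr_sumr; apply: eq_bigr => p _; rewrite rmorphM mulrA.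
suff [s [sJ sE]] : L (tact u v (\det (colsub f X))).
  exists s => // R g x; have [w [<- <-]] := pair R g x.
  rewrite -tact_nat acompE sE rmorph_sum; apply: eq_bigr => p _.
  by rewrite rmorphM.
have -> : tact u v (\det (colsub f X)) =
    \det ((map_mx (tact u v) X *m map_mx u t) *m colsub f (map_mx (ginv u) t)).
  rewrite -mulmxA mulmx_colsub ht.2 -det_map_mx; congr (\det _).
  by rewrite mulmx_colsub mulmx1; apply/matrixP => i j; rewrite !mxE.
set Tf := colsub f _; set Y := _ *m map_mx u t.
pose V w := exists2 a, relation a & w = map_mx v a *m Tf.
apply: (det_spanned (S := U) (L := L) (U := V)) => // [M MV|i]; last first.
  have [s [sR sE]] := relation_stable (Xrel i).
  exists [seq (u p.1, map_mx v p.2 *m Tf) | p <- s]; split.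
    by move=> _ /mapP[p /sR pR ->]; split; [exists p.1|exists p.2].
  rewrite row_mul row_mul -map_row sE mulmx_suml big_map.
  by apply: eq_bigr => p _; rewrite scalemxAl.
have [X' X'P] : exists X' : 'M[B]_(r, n),
    (forall i, relation (row i X')) /\ M = map_mx v X' *m Tf.
  have [a aP] := choice (fun i => let: ex_intro2 a ar aE := MV i in
    ex_intro (fun a => relation a /\ row i M = map_mx v a *m Tf) a (conj ar aE)).
  exists (\matrix_i a i); split=> [i|]; first by rewrite rowK; case: (aP i).
  apply/row_matrixP => i; rewrite row_mul -map_row rowK.
  by case: (aP i).
(* Transposition turns the second expansion, by columns of X', into one by rows. *)
case: X'P => X'rel ->; rewrite -det_tr trmx_mul.
pose V' (w : 'rV[T]_r) := exists l, w = row l (map_mx v X')^T.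
apply: (det_spanned (S := U) (L := L) (U := V')) => // [M' M'V|i]; last first.
  exists [seq (Tf^T i l, row l (map_mx v X')^T) | l <- index_enum 'I_n]; split.
    move=> _ /mapP[l _ ->]; split; last by exists l.
    by exists (antipode G (t l (f i))); rewrite !mxE ginvE.
  by rewrite row_mul mulmx_sum_row big_map; apply: eq_bigr => l _; rewrite mxE.
have [f' f'P] := choice M'V.
have -> : M' = (map_mx v (colsub f' X'))^T.
  by apply/row_matrixP => i; rewrite f'P; apply/rowP => j; rewrite !mxE.
rewrite det_tr det_map_mx; exists [:: (1, \det (colsub f' X'))]; split.
  move=> p; rewrite inE => /eqP -> /=.
  exists [:: (1, X', finfun f')]; split.
    by move=> q; rewrite inE => /eqP -> /=; split=> //; case: A_alg.
  rewrite big_seq1 /= mul1r; congr (\det _); apply/matrixP => i j.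
  by rewrite !mxE ffunE.
by rewrite big_seq1 rmorph1 mul1r.
Qed.
End Minors.

Lemma relation_split : exists E : 'M[B]_n,
  (forall i, relation (row i E)) /\ forall x, relation x -> x *m E = x.
Proof.
apply: (relation_projector invar_subring) => [||u [uA _]//|r X f Xrel /eqP det_n0].
- exact: relation0.
- exact: relationL.
have [s sE sJ] := minor_coact f Xrel.
apply: (stable_ideal_unit (minor_ideal_submodule r) _ det_n0 _ sE sJ).
  by move=> a x; apply: minor_idealM.
apply: (subring_det invar_subring) => i j; rewrite mxE.
by have [/(_ (f j)) + _] := Xrel i; rewrite mxE.
Qed.
End Relations.

Section Flatness.
Variables (k : fieldType) (G : group_scheme k) (P : torsor G).
Local Notation H := (gring G).
Local Notation B := (tring P).
Variables (K : H -> Prop) (K_hopf : sub_hopf K).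
Local Notation A := (@invar k G P K).

Let A_alg : subalgebra A := invar_subalgebra P K_hopf.
Let A_sub : submodule A := subalgebra_submodule A_alg.

(** The second algebra [K'] keeps the new generators in the ring that contains the [g i], as
    flatness of a transition map requires. *)
Lemma invar_flat (K' : H -> Prop) m (a g : 'I_m -> B) :
  sub_hopf K' ->
  (forall i, A (a i)) -> (forall i, invar K' (g i)) -> \sum_i a i * g i = 0 ->
  exists n (c : 'M[B]_(m, n)) (y : 'I_n -> B),
  [/\ forall i j, A (c i j), forall j, invar K' (y j),
      forall i, g i = \sum_j c i j * y j & forall j, \sum_i a i * c i j = 0].
Proof.
move=> K'_hopf aA gK' ag0.
have [n [h [t [ht [c gE] hK']]]] := comodule_family g.
have [||b s phi -> sE|E [Erel Eid]] :=
    @relation_split k G P K K_hopf n h t ht (fun b => b = 0).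
- by split=> // x u v -> ->; rewrite scaler0 addr0.
- by move=> x y _ ->; rewrite mulr0.
- have s0 : tzero s by move=> R f x; rewrite -sE rmorph0.
  exact: tzero_slicel.
have Eh : E *m h = 0.
  apply/colP => i; rewrite [RHS]mxE; have [_ /=] := Erel i.
  by rewrite -row_mul mxE.
pose cB : 'M[B]_(m, n) := \matrix_(i, j) (c i j)%:A.
have gcB i : g i = (cB *m h) i 0.
  by rewrite gE mxE; apply: eq_bigr => j _; rewrite mxE mulr_algl.
(* Rows of [E] are relations, so E h = 0 and 1 - E fixes h; the row a cB is a relation, so 1 - E
   kills it. *)
exists n, (cB *m (1%:M - E)), (fun j => h j 0); split.
- have AS := invar_subring P K_hopf.
  apply: (subring_mulmx AS) => i j; rewrite !mxE.
    by apply: submoduleZ => //; case: A_alg.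
  apply: (subringB AS); first by case: eqP => _; [exact: subring1|exact: subring0].
  by have [/(_ j) + _] := Erel i; rewrite mxE.
- exact: hK'.
- move=> i; rewrite gcB -[X in cB *m X]subr0 -Eh -[X in X - _]mul1mx -mulmxBl.
  by rewrite mulmxA mxE.
- pose a' := \row_i a i *m cB.
  have a'rel : a' *m E = a'.
    apply: Eid; split=> [i|].
      rewrite mxE; apply: submodule_sum => // j _; rewrite !mxE mulrC mulr_algl.
      exact: submoduleZ.
    rewrite -mulmxA mxE -[RHS]ag0; apply: eq_bigr => i _.
    by rewrite -gcB mxE.
  move=> j; have : (a' *m (1%:M - E)) 0 j = 0.
    by rewrite mulmxBr mulmx1 a'rel subrr mxE.
  rewrite -mulmxA mxE => j0; rewrite -[RHS]j0; apply: eq_bigr => i _.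
  by congr (_ * _); rewrite mxE.
Qed.

(** Here relations are rows whose combination with h falls in the ring of the quotient. The row x'
    expressing the sum through h has entries in J and is fixed by [E], so the sum is x' (E h) with E
    h over that ring. *)
Lemma invar_pure (J : B -> Prop) m (x g : 'I_m -> B) :
  submodule J -> (forall a b, A a -> J b -> J (a * b)) ->
  (forall b, J b -> A b) ->
  (forall i, J (x i)) -> A (\sum_i x i * g i) -> J (\sum_i x i * g i).
Proof.
move=> Jsub JA JsubA xJ sA.
have [n [h [t [ht [c gE] _]]]] := comodule_family g.
have [||b s phi bA sE|E [Erel Eid]] :=
    @relation_split k G P K K_hopf n h t ht A.
- exact: A_sub.
- by move=> a b Aa Ab; exact: (subalgebraM A_alg Aa Ab).
- exact: (invar_slice K_hopf phi bA sE).
pose cB : 'M[B]_(m, n) := \matrix_(i, j) (c i j)%:A.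
have gcB i : g i = (cB *m h) i 0.
  by rewrite gE mxE; apply: eq_bigr => j _; rewrite mxE mulr_algl.
pose x' := \row_i x i *m cB.
have x'J i : J (x' 0 i).
  rewrite mxE; apply: submodule_sum => // j _; rewrite !mxE mulrC mulr_algl.
  exact: submoduleZ.
have x'E : \sum_i x i * g i = (x' *m h) 0 0.
  by rewrite -mulmxA mxE; apply: eq_bigr => i _; rewrite -gcB mxE.
have x'rel : x' *m E = x'.
  by apply: Eid; split=> [i|]; [apply: JsubA|rewrite -x'E].
rewrite x'E -x'rel -mulmxA mxE; apply: submodule_sum => // i _.
rewrite mulrC; apply: JA => //.
by have [_] := Erel i; rewrite -row_mul mxE.
Qed.
End Flatness.

(** * Lying over, finiteness and limits *)

(** The hypothesis says that pB contracts into p for every proper ideal p. An ideal of B maximal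
    among those containing pB and contracting into p is prime. *)
Lemma lying_over (A B : comNzRingType) (f : {rmorphism A -> B}) :
  (forall p : {pred A}, idealr_closed p ->
     forall m (x : 'I_m -> A) (g : 'I_m -> B) a,
     (forall i, x i \in p) -> \sum_i f (x i) * g i = f a -> a \in p) ->
  forall p : {pred A}, prime_ideal p ->
    exists q : {pred B}, prime_ideal q /\ forall a, (f a \in q) = (a \in p).
Proof.
move=> pure p [p_ideal p_prime]; have [p0 p1 pL] := p_ideal.
pose J0 (b : B) := exists s : seq (A * B),
  (forall r, r \in s -> r.1 \in p) /\ b = \sum_(r <- s) f r.1 * r.2.
pose Q (J : B -> Prop) := @submodule B B^o J /\ forall a, J (f a) -> a \in p.
have [||J [[Jsub Jp] J0J Jmax]] := @zorn_above B Q J0.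
- split; first split.
  + by exists [::]; rewrite big_nil.
  + move=> c u v [s [sp ->]] [s' [s'p ->]].
    exists ([seq (r.1, c * r.2) | r <- s] ++ s'); split.
      by move=> r; rewrite mem_cat => /orP[/mapP[r' /sp ? ->]|/s'p].
    rewrite big_cat big_map; congr (_ + _).
    by rewrite [LHS]mulr_sumr; apply: eq_bigr => r _; rewrite mulrCA.
  move=> a [s [sp aE]].
  apply: (pure p p_ideal _ (fun i => (tnth (in_tuple s) i).1)
    (fun i => (tnth (in_tuple s) i).2)).
    by move=> i; apply: sp; apply: mem_tnth.
  by rewrite aE -(big_tuple _ _ (in_tuple s) xpredT (fun r => f r.1 * r.2)).
- move=> F F0 FQ Ftot; split.
    by apply: (@submodule_chain B B^o) => // X /FQ[].
  by move=> a [X /FQ[_ Xp] /Xp].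
have JZ c u : J u -> J (c * u) by move=> Ju; apply: (submoduleZ Jsub c Ju).
have out u : ~ J u -> exists a j b, [/\ a \notin p, J j & f a = j + b * u].
  move=> nJu; apply: contrapT => no.
  apply: nJu; pose J' (x : B) := exists j b, J j /\ x = j + b * u.
  have : (J' `<=` J)%classic.
    apply: Jmax => [|x Jx]; last by exists x, 0; rewrite mul0r addr0.
    split; first split.
    - by exists 0, 0; rewrite mul0r addr0; split=> //; apply: submodule0 Jsub.
    - move=> c _ _ [j [b [Jj ->]]] [j' [b' [Jj' ->]]].
      exists (c * j + j'), (c * b + b'); split; first exact: Jsub.2.
      by rewrite /GRing.scale /= mulrDr mulrDl mulrA addrACA.
    - move=> a [j [b [Jj aE]]]; apply: contraT => ap.
      by exfalso; apply: no; exists a, j, b.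
  apply; exists 0, 1; rewrite mul1r add0r; split=> //.
  exact: submodule0 Jsub.
exists (fun b => `[< J b >]); split; last first.
  move=> a; apply/asboolP/idP => [/Jp//|ap]; apply: J0J.
  exists [:: (a, 1)]; rewrite big_seq1 mulr1; split=> // r.
  by rewrite inE => /eqP ->.
split; first split.
- by apply/asboolP; apply: submodule0 Jsub.
- by apply: contra p1 => /asboolP; rewrite -(rmorph1 f) => /Jp.
- move=> c u v /asboolP Ju /asboolP Jv; apply/asboolP.
  exact: (Jsub.2 c u v Ju Jv).
move=> u v /asboolP Juv; apply: contraT; rewrite negb_or => /andP[].
move=> /asboolP/out[a [j [b [ap Jj aE]]]] /asboolP/out[a' [j' [b' [a'p Jj' a'E]]]].
(* For u, v outside J the ideals J + Bu and J + Bv meet f(A) in f a, f a' with a, a' outside p; if u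
   v were in J, then so would be f (a a'). *)
have /Jp/p_prime : J (f (a * a')).
  rewrite rmorphM aE a'E mulrDl [X in _ + X]mulrDr.
  apply: (submoduleD Jsub); first by rewrite mulrC; apply: JZ.
  by apply: (submoduleD Jsub); [|rewrite mulrACA]; apply: JZ.
by rewrite (negPf ap) (negPf a'p).
Qed.

Section FiniteType.
Variable k : fieldType.

Lemma mpoly_eval (T : comAlgType k) n (v : 'I_n -> T) :
  exists ev : points (mpoly.mpoly n k) T,
    forall i, ev (mpoly.mpolyX k (mpoly.mnm1 i)) = v i.
Proof.
pose io : {rmorphism k -> T} := GRing.in_alg T.
have [|||ev evE] := @point_of k (mpoly.mpoly n k) T (mpoly.mmap io v).
- by move=> c x y; rewrite mpoly.mmapD mpoly.mmapZ /= mulr_algl.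
- by move=> x y; rewrite rmorphM.
- by rewrite rmorph1.
by exists ev => i; rewrite evE mpoly.mmapX mpoly.mmap1U.
Qed.

Lemma mpoly_subalgebra n (A : mpoly.mpoly n k -> Prop) :
  @subalgebra k (mpoly.mpoly n k) A ->
  (forall i, A (mpoly.mpolyX k (mpoly.mnm1 i))) -> forall q, A q.
Proof.
move=> A_alg AX; have A_sub := subalgebra_submodule A_alg.
have A1 : A 1 by case: A_alg.
have AXn i m : A (mpoly.mpolyX k (mpoly.mnm1 i) ^+ m).
  by elim: m => [|m IHm]; rewrite ?expr0 // exprS; apply: subalgebraM.
apply: mpoly.mpolyind => [|c m q _ _ Aq]; first exact: submodule0 A_sub.
apply: A_sub.2 => //; rewrite mpoly.mpolyXE_id.
by apply: (big_ind A A1 (subalgebraM A_alg)).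
Qed.

Variables (G : group_scheme k) (P : torsor G) (K : gring G -> Prop).
Hypothesis K_hopf : sub_hopf K.

(** It reduces a condition on all of [K] to its algebra generators. *)
Lemma tdiv_subalgebra (C : tring P -> Prop) : subalgebra C ->
  subalgebra (fun h => exists2 s : seq (tring P * tring P), tdiv_expr h s &
    forall p, p \in s -> C p.1).
Proof.
move=> C_alg; have C_sub := subalgebra_submodule C_alg; split.
- exists [:: (1, 1)] => [R x y|p]; first by rewrite big_seq1 !rmorph1 mulr1.
  by rewrite inE => /eqP ->; case: C_alg.
- move=> c b b' [s sE sK] [s' s'E s'K]; exists (fscale c s ++ s') => [R g x|p].
    rewrite linearP /= sE s'E big_cat big_map scaler_sumr; congr (_ + _).
    by apply: eq_bigr => p _; rewrite linearZ scalerAl.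
  by rewrite mem_cat => /orP[/mapP[r /sK Kr ->]|/s'K//]; apply: submoduleZ.
- move=> b b' [s sE sK] [s' s'E s'K]; exists (lmul s s') => [R g x|p].
    rewrite rmorphM /= sE s'E (sum_lmul (fun a b => g a * x b)) mulr_suml.
    apply: eq_bigr => p _; rewrite mulr_sumr; apply: eq_bigr => r _.
    by rewrite !rmorphM mulrACA.
  move=> /allpairsP[[r r'] [/= /sK ? /s'K ? ->]].
  exact: subalgebraM.
Qed.

(** The generators are the left entries of expressions of the [X i] at x / y. Every element of [K]
    then has an expression with left entries in the subalgebra [C] they generate, and writing b(x)
    as b((x / y) y) puts b (x) 1 in C (x) B. *)
Lemma invar_finite_type (F : comAlgType k) (f : points F (gring G))
    (T : comAlgType k) (e : points T (tring P)) :
  finite_type F -> (forall h, K h <-> exists a, f a = h) ->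
  injective e -> (forall b, invar K b <-> exists t, e t = b) ->
  finite_type T.
Proof.
move=> [n [phi phi_surj]] fK e_inj eA.
have A_alg := invar_subalgebra P K_hopf.
pose X i := f (phi (mpoly.mpolyX k (mpoly.mnm1 i))).
have KX i : K (X i) by apply/fK; exists (phi (mpoly.mpolyX k (mpoly.mnm1 i))).
have [s sP] := choice (fun i => let: ex_intro2 s sE sA :=
  tdiv_invar_l P K_hopf (KX i) in ex_intro (fun s => tdiv_expr (X i) s /\
    forall p, p \in s -> invar K p.1) s (conj sE sA)).
pose us := flatten [seq [seq p.1 | p <- s i] | i <- index_enum 'I_n].
have usA b : b \in us -> invar K b.
  by move=> /flatten_mapP[i _ /mapP[p pi ->]]; case: (sP i) => _ /(_ p pi).
have [v vE] : exists v : 'I_(size us) -> T, forall i, e (v i) = tnth (in_tuple us) i.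
  have ex i : exists t, e t = tnth (in_tuple us) i.
    by apply/eA/usA; apply: mem_tnth.
  by have [v vE] := choice ex; exists v.
have [ev evX] := mpoly_eval v.
pose C b := exists q, e (ev q) = b.
have C_alg : subalgebra C.
  split; first by exists 1; rewrite !rmorph1.
    by move=> c _ _ [q <-] [q' <-]; exists (c *: q + q'); rewrite !linearP.
  by move=> _ _ [q <-] [q' <-]; exists (q * q'); rewrite !rmorphM.
have C_sub := subalgebra_submodule C_alg.
have usC b : b \in us -> C b.
  move=> /(tnthP (in_tuple us))[i ->].
  by exists (mpoly.mpolyX k (mpoly.mnm1 i)); rewrite evX vE.
have D_alg := tdiv_subalgebra C_alg.
have KD h : K h -> exists2 d : seq (tring P * tring P), tdiv_expr h d &
    forall p, p \in d -> C p.1.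
  move=> /fK[a <-]; have [q <-] := phi_surj a.
  apply: (@mpoly_subalgebra n (fun q => exists2 d : seq (tring P * tring P),
    tdiv_expr (f (phi q)) d & forall p, p \in d -> C p.1)) => [|i].
    case: D_alg => D1 DL DM; split; first by rewrite !rmorph1.
      by move=> c x y Dx Dy; rewrite !linearP; apply: DL.
    by move=> x y Dx Dy; rewrite !rmorphM; apply: DM.
  exists (s i); first by case: (sP i).
  move=> p psi; apply: usC; apply/flatten_mapP; exists i.
    by rewrite mem_index_enum.
  by apply/mapP; exists p.
suff invC b : invar K b -> C b.
  exists (size us), ev => t; have [q qE] : C (e t) by apply/invC/eA; exists t.
  by exists q; apply: e_inj.
move=> [s0 s0E s0K].
have ex h : exists d : seq (tring P * tring P), K h -> tdiv_expr h d /\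
    forall v, v \in d -> C v.1.
  have [/KD[d dE dC]|nKh] := pselect (K h); last by exists [::] => /nKh.
  by exists d.
have [d dP] := choice ex.
pose L := [:: (b, 1)] ++
  fneg (flatten [seq [seq (v.1, v.2 * p.2) | v <- d p.1] | p <- s0]).
have L0 : tzero L.
  move=> R x y; rewrite big_cat big_seq1 big_map big_flatten big_map /=.
  apply/eqP; rewrite rmorph1 mulr1 addr_eq0 -sumrN; apply/eqP.
  transitivity (tact (tdiv x y) y b); first by rewrite tdivP.
  rewrite s0E big_seq [RHS]big_seq; apply: eq_bigr => p ps0.
  have [-> _] := dP p.1 (s0K p ps0).
  rewrite big_map mulr_suml -sumrN; apply: eq_bigr => w _.
  by rewrite rmorphN mulNr opprK /= rmorphM mulrA.
(* Slicing the right factor by a functional equal to 1 at 1 recovers b from b (x) 1. *)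
have [psi psi1] := functional_neq0 (elimN eqP (oner_neq0 (tring P))).
have := tzero_slicer psi L0.
rewrite big_cat big_seq1 big_map /= psi1 scale1r => /eqP.
rewrite addr_eq0 => /eqP ->; apply: submoduleN => //.
apply: submodule_sum_seq => // _ /flatten_mapP[p ps0 /mapP[w wd ->]] /=.
apply: submoduleZ => //; apply: submoduleN => //.
by have [_] := dP p.1 (s0K p ps0); apply.
Qed.
End FiniteType.

Section Transition.
Variables (k : fieldType) (G : group_scheme k) (P : torsor G).
Local Notation H := (gring G).
Local Notation B := (tring P).
Variables (K K' : H -> Prop) (K_hopf : sub_hopf K) (K'_hopf : sub_hopf K').
Variables (T T' : comAlgType k) (e : points T B) (e' : points T' B).
Hypotheses (e_inj : injective e) (e'_inj : injective e').
Hypotheses (eA : forall b, invar K b <-> exists t, e t = b).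
Hypotheses (e'A : forall b, invar K' b <-> exists t, e' t = b).
Variable f : points T T'.
Hypothesis fe : forall t, e' (f t) = e t.

Lemma transition_eq_flat : @eq_flat T (restr_scalars f).
Proof.
move=> n a g ag0.
have [|||m [c [y [cA yA gE acE]]]] :=
    @invar_flat k G P K K_hopf K' n (fun i => e (a i)) (fun i => e' (g i)) K'_hopf.
- by move=> i; apply/eA; exists (a i).
- by move=> i; apply/e'A; exists (g i).
- transitivity (e' (\sum_i f (a i) * (g i : T'))).
    by rewrite rmorph_sum; apply: eq_bigr => i _; rewrite -fe -rmorphM.
  by rewrite [\sum_i _]ag0 rmorph0.
have [c' c'E] := choice (fun ij : 'I_n * 'I_m => (eA _).1 (cA ij.1 ij.2)).
have [y' y'E] := choice (fun j => (e'A _).1 (yA j)).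
exists m, (\matrix_(i, j) c' (i, j)), y'; split=> [i|j].
  apply: e'_inj; rewrite gE rmorph_sum; apply: eq_bigr => j _.
  by rewrite mxE -y'E -(c'E (i, j)) -fe -rmorphM.
apply: e_inj; rewrite rmorph0 -[RHS](acE j) rmorph_sum; apply: eq_bigr => i _.
by rewrite mxE rmorphM /= c'E.
Qed.

Lemma transition_faithfully_flat : faithfully_flat f.
Proof.
split; first exact: flat_module_eq_flat transition_eq_flat.
apply: lying_over => p [p0 _ pL] m x g a xp xgE.
(* The ideal p is viewed inside B, where [invar_pure] applies. *)
pose J b := exists2 t, e t = b & t \in p.
suff : J (\sum_i e (x i) * e' (g i)).
  have -> : \sum_i e (x i) * e' (g i) = e a.
    rewrite -fe -xgE rmorph_sum; apply: eq_bigr => i _.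
    by rewrite rmorphM /= fe.
  by move=> [t /e_inj <-].
apply: (@invar_pure k G P K K_hopf J) => [|b b'|b|i|].
- split; first by exists 0; rewrite ?rmorph0.
  move=> c _ _ [t <- tp] [t' <- t'p]; exists (c *: t + t'); first by rewrite linearP.
  by rewrite -[t]mul1r scalerAl; apply: pL.
- move=> /eA[t <-] [t' <- t'p]; exists (t * t'); first by rewrite rmorphM.
  by rewrite -[_ * _]addr0; apply: pL.
- by move=> [t <- _]; apply/eA; exists t.
- by exists (x i).
- apply/eA; exists a; rewrite -fe -xgE rmorph_sum; apply: eq_bigr => i _.
  by rewrite rmorphM /= fe.
Qed.
End Transition.

(** The map out of the union is forced on each piece; two representatives of an element agree at a
    common upper bound by injectivity there. *)
Lemma directed_union_limit (k : fieldType) d (I : porderType d)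
    (S : inverse_system k I) (B : comAlgType k)
    (e : forall i, {lrmorphism sobj S i -> B}) :
  directed I -> is_cone e -> (forall i, injective (e i)) ->
  (forall b, exists i t, e i t = b) -> is_limit e.
Proof.
move=> [_ dir] e_cone e_inj e_surj; split=> // C q q_cone.
have common (i j : I) : exists l (il : (i <= l)%O) (jl : (j <= l)%O), True.
  by have [l [il jl]] := dir i j; exists l, il, jl.
have up i l (il : (i <= l)%O) t : e l (strans S il t) = e i t /\
    q l (strans S il t) = q i t.
  by rewrite -(e_cone _ _ il) -(q_cone _ _ il).
have well i j t t' : e i t = e j t' -> q i t = q j t'.
  have [l [il [jl _]]] := common i j.
  have [<- <-] := up _ _ il t; have [<- <-] := up _ _ jl t'.
  by move=> /e_inj ->.
have ex b : exists c, forall i t, e i t = b -> q i t = c.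
  have [i [t tb]] := e_surj b; exists (q i t) => j t' t'b.
  by apply: well; rewrite t'b.
have [u uP] := choice ex.
have uE i t : u (e i t) = q i t by rewrite (uP (e i t) i t).
have two b b' : exists l t t', e l t = b /\ e l t' = b'.
  have [i [t <-]] := e_surj b; have [j [t' <-]] := e_surj b'.
  have [l [il [jl _]]] := common i j; exists l, (strans S il t), (strans S jl t').
  by have [-> _] := up _ _ il t; have [-> _] := up _ _ jl t'.
have [|||v vE] := @point_of k B C u.
- move=> c b b'; have [l [t [t' [<- <-]]]] := two b b'.
  by rewrite -linearP !uE linearP.
- move=> b b'; have [l [t [t' [<- <-]]]] := two b b'.
  by rewrite -rmorphM !uE rmorphM.
- by have [l [t _]] := e_surj 1; rewrite -(rmorph1 (e l)) uE rmorph1.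
exists v; split=> [i t|w wE]; first by rewrite /= vE uE.
apply: points_eq => b; have [i [t <-]] := e_surj b.
by rewrite vE uE -wE.
Qed.

Theorem proposition2 (k : fieldType) (d : Order.disp_t) (I : porderType d)
    (I_directed : directed I)
    (S : group_inverse_system k I)
    (S_finite_type : forall i : I, finite_type (gring (gobj S i)))
    (G : group_scheme k)
    (p : forall i : I, {lrmorphism gring (gobj S i) -> gring G})
    (G_limit : is_group_limit p)
    (P : torsor G) :
  exists (d' : Order.disp_t) (Omega : porderType d')
      (T : inverse_system k Omega)
      (q : forall w : Omega, {lrmorphism sobj T w -> tring P}),
    [/\ directed Omega,
        exists f : Omega -> I, bijective f,
        forall w : Omega, finite_type (sobj T w),
        forall (w1 w2 : Omega) (h : (w1 <= w2)%O),
          faithfully_flat (strans T h)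
      & is_limit q].
Proof.
have [[p_hom p_cone] _] := G_limit.
pose K i h := exists a, p i a = h.
have K_hopf i : sub_hopf (K i) by apply: image_sub_hopf.
have K_mono i j : (i <= j)%O -> forall h, K i h -> K j h.
  by move=> ij _ [a <-]; exists (gtrans S ij a); rewrite -(p_cone _ _ ij).
have K_union := group_limit_generated I_directed G_limit.
(* The algebra and its embedding are packed together so that one choice over i yields both. *)
have ex i : exists Te : {T : comAlgType k & points T (tring P)},
    injective (projT2 Te) /\
    forall b, invar (K i) b <-> exists t, projT2 Te t = b.
  have [T [e [e_inj eA]]] := subalgebra_type (invar_subalgebra P (K_hopf i)).
  by exists (existT _ T e).
have [Te TeP] := choice ex.
pose T i := projT1 (Te i); pose e i : points (T i) (tring P) := projT2 (Te i).
have e_inj i : injective (e i) by case: (TeP i).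
have eA i b : invar (K i) b <-> exists t, e i t = b by case: (TeP i).
have trP i j (ij : (i <= j)%O) : exists f : points (T i) (T j), acomp f (e j) = e i.
  apply: point_factor => // t; apply/eA.
  have [s sE sK] : invar (K i) (e i t) by apply/eA; exists t.
  by exists s => // r /sK; apply: K_mono.
pose tr i j ij := projT1 (cid (trP i j ij)).
have trE i j ij t : e j (tr i j ij t) = e i t.
  by rewrite /tr; case: cid => f /= fE; exact: (congr1 (fun g : points _ _ => g t) fE).
have tr_id i (ii : (i <= i)%O) : tr i i ii =1 id.
  by move=> t; apply: e_inj; rewrite trE.
have tr_comp i j l (ij : (i <= j)%O) (jl : (j <= l)%O) (il : (i <= l)%O) :
    tr j l jl \o tr i j ij =1 tr i l il.
  by move=> t; apply: e_inj; rewrite /= !trE.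
pose Ts : inverse_system k I := InverseSystem tr_id tr_comp.
exists d, I, Ts, e; split=> //.
- by exists id; exists id.
- move=> i; apply: (invar_finite_type (K_hopf i) (S_finite_type i)
    (f := p i)) => //; exact: eA.
- move=> i j ij.
  apply: (transition_faithfully_flat (K_hopf i) (K_hopf j)) => //; exact: trE.
apply: directed_union_limit => // b.
have [s sE] := coact_exists b.
suff [i sK] : exists i, forall r, r \in s -> K i r.1.
  have /eA[t tE] : invar (K i) b by exists s.
  by exists i, t.
(* The coaction of b involves finitely many elements of H, so directedness puts them in one
   [K i]. *)
elim: s {sE} => [|r s [i sK]]; first by case: I_directed => -[i] _; exists i.
have [j [a aE]] := K_union r.1.
have [_ /(_ i j)[l [il jl]]] := I_directed.
exists l => r'; rewrite inE => /predU1P[->|/sK]; last exact: K_mono.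
by apply: K_mono jl _ _; exists a.
Qed.
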